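(* (Wakamatsu's Lemma) Let $n\ge 1$ be an integer, let $\Lambda$ be an Artin algebra and let $\mathscr{M}$ be an $n\mathbb{Z}$-cluster tilting subcategory of $\mathrm{mod}\,\Lambda$. Let $\mathscr{X}\subseteq\mathscr{M}$ be a full subcategory which is left closed under $n$-extensions. Let $m\in\mathscr{M}$ and let $f:x\to m$ be a surjective $\mathscr{X}$-cover of $m$. Then for every $n$-kernel $k_n\to\cdots\to k_1$ of $f$ in $\mathscr{M}$ and every $x'\in\mathscr{X}$, the induced sequence of abelian groups $$0\to\mathrm{Ext}^n_{\Lambda}(x',k_n)\to\cdots\to\mathrm{Ext}^n_{\Lambda}(x',k_1)\to 0$$ is exact.
   Context: $\mathrm{mod}\,\Lambda$ is the category of finitely generated right $\Lambda$-modules; $\mathscr{M}(-,-)$ denotes Hom in $\mathscr{M}$. An additive full subcategory $\mathscr{M}$ of an abelian category $\mathscr{A}$ is called $n$-cluster tilting if: it is functorially finite in $\mathscr{A}$ (every object of $\mathscr{A}$ has a right and a left $\mathscr{M}$-approximation); it is generating and cogenerating (for every $a\in\mathscr{A}$ there are an epimorphism $m\to a$ and a monomorphism $a\to m'$ with $m,m'\in\mathscr{M}$); and $$\mathscr{M}=\{a\in\mathscr{A}\mid \mathrm{Ext}^i_{\mathscr{A}}(\mathscr{M},a)=0,\ 0<i<n\}=\{a\in\mathscr{A}\mid \mathrm{Ext}^i_{\mathscr{A}}(a,\mathscr{M})=0,\ 0<i<n\}.$$ An $n$-exact sequence in $\mathscr{M}$ is an exact sequence $0\to m_{n+1}\to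 m_n\to\cdots\to m_1\to m_0\to 0$ in $\mathrm{mod}\,\Lambda$ with all terms in $\mathscr{M}$. An $n$-cluster tilting subcategory $\mathscr{M}$ of $\mathrm{mod}\,\Lambda$ is $n\mathbb{Z}$-cluster tilting if for each $m\in\mathscr{M}$ and each $n$-exact sequence $0\to m_{n+1}\to\cdots\to m_0\to 0$ in $\mathscr{M}$ there is a long exact sequence $$0\to\mathscr{M}(m,m_{n+1})\to\cdots\to\mathscr{M}(m,m_0)\to\mathrm{Ext}^n_\Lambda(m,m_{n+1})\to\cdots\to\mathrm{Ext}^n_\Lambda(m,m_0)\to\mathrm{Ext}^{2n}_\Lambda(m,m_{n+1})\to\cdots$$ of abelian groups (with the induced maps and connecting maps); equivalently, $\mathscr{M}$ is closed under $n$-syzygies, i.e. for every exact sequence $0\to k\to p_n\to\cdots\to p_1\to m\to 0$ in $\mathrm{mod}\,\Lambda$ with $m\in\mathscr{M}$ and all $p_i$ projective, one has $k\in\mathscr{M}$. An $n$-kernel in $\mathscr{M}$ of a morphism $f:x\to m$ in $\mathscr{M}$ is a sequence $k_n\to\cdots\to k_1\to x$ of morphisms in $\mathscr{M}$ (also written $k_n\to\cdots\to k_1$) such that for every $m'\in\mathscr{M}$ the induced sequence $0\to\mathscr{M}(m',k_n)\to\cdots\to\mathscr{M}(m',k_1)\to\mathscr{M}(m',x)\to\mathscr{M}(m',m)$ is exact. An $\mathscr{X}$-precover of $m$ is a morphism $f:x\to m$ with $x\in\mathscr{X}$ such that every morphism $x'\to m$ with $x'\in\mathscr{X}$ factors through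 $f$; it is an $\mathscr{X}$-cover if moreover every endomorphism $\psi:x\to x$ with $f\psi=f$ is an automorphism. The Jacobson radical of $\mathscr{M}$ is given by $\mathrm{rad}_{\mathscr{M}}(m,m')=\{f:m\to m'\mid 1_m-gf \text{ is invertible for every } g:m'\to m\}$. An $n$-exact sequence $0\to m_{n+1}\xrightarrow{u_{n+1}}m_n\xrightarrow{u_n}\cdots\xrightarrow{u_2}m_1\xrightarrow{u_1}m_0\to 0$ in $\mathscr{M}$ is almost-minimal if $u_i$ lies in the Jacobson radical of $\mathscr{M}$ for all $2\le i\le n$. $\mathscr{X}$ is left closed under $n$-extensions if for each almost-minimal $n$-exact sequence $0\to x\to x_n\to x_{n-1}\to\cdots\to x_1\to x'\to 0$ in $\mathscr{M}$ with $x,x'\in\mathscr{X}$ one has $x_n\in\mathscr{X}$. *)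

(* Defs.v *)
From HB Require Import structures.
From mathcomp Require Import all_boot all_order all_algebra.
From mathcomp Require Import boolp.
From mathcomp Require Import finmap monalg.

Set Implicit Arguments.
Unset Strict Implicit.
Unset Printing Implicit Defensive.

Import GRing.Theory.

Local Open Scope ring_scope.
Local Open Scope quotient_scope.

Definition finitely_generated (R : pzRingType) (A : lmodType R) : Prop :=
  exists s : seq A, forall x : A,
    exists c : 'I_(size s) -> R, x = \sum_(i < size s) c i *: s`_i.

Definition ideal (k : comNzRingType) (I : k -> Prop) : Prop :=
  [/\ I 0, forall x y, I x -> I y -> I (x + y) & forall a x, I x -> I (a * x)].

Definition artinian (k : comNzRingType) : Prop :=
  forall I : nat -> k -> Prop,
    (forall i, ideal (I i)) -> (forall i x, I i.+1 x -> I i x) ->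
    exists N, forall i, (N <= i)%N -> forall x, I N x -> I i x.

Definition artin_algebra (k : comNzRingType) (L : algType k) : Prop :=
  artinian k /\ finitely_generated (L : lmodType k).

Lemma linear_ext (R : pzRingType) (A B : lmodType R) (f g : {linear A -> B}) :
  f =1 g -> f = g.
Proof.
case: f g => [f [[Hf] [Hf']]] [g [[Hg] [Hg']]] /= /funext fg.
case: _ / fg in Hg Hg' *.
by rewrite (Prop_irrelevance Hg Hf) (Prop_irrelevance Hg' Hf').
Qed.

(* {linear A -> B} as an abelian group; there is no scalar action since R need
   not be commutative. *)
Section Hom.
Context {R : pzRingType} {A B : lmodType R}.

HB.instance Definition _ := gen_eqMixin {linear A -> B}.
HB.instance Definition _ := gen_choiceMixin {linear A -> B}.

Definition hom_zero : {linear A -> B} := \0.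
Definition hom_opp (f : {linear A -> B}) : {linear A -> B} := \- f.
Definition hom_add (f g : {linear A -> B}) : {linear A -> B} := f \+ g.

Fact hom_addA : associative hom_add.
Proof. by move=> f g h; apply: linear_ext => x; apply: addrA. Qed.

Fact hom_addC : commutative hom_add.
Proof. by move=> f g; apply: linear_ext => x; apply: addrC. Qed.

Fact hom_add0 : left_id hom_zero hom_add.
Proof. by move=> f; apply: linear_ext => x; apply: add0r. Qed.

Fact hom_addN : left_inverse hom_zero hom_opp hom_add.
Proof. by move=> f; apply: linear_ext => x; apply: addNr. Qed.

HB.instance Definition _ := GRing.isZmodule.Build {linear A -> B}
  hom_addA hom_addC hom_add0 hom_addN.

Lemma hom0E x : (0 : {linear A -> B}) x = 0. Proof. by []. Qed.
Lemma homDE (f g : {linear A -> B}) x : (f + g) x = f x + g x.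
Proof. by []. Qed.
Lemma homNE (f : {linear A -> B}) x : (- f) x = - f x. Proof. by []. Qed.
Lemma homBE (f g : {linear A -> B}) x : (f - g) x = f x - g x.
Proof. by []. Qed.

End Hom.

Definition hom_comp (R : pzRingType) (A B C : lmodType R)
  (u : {linear B -> C}) (f : {linear A -> B}) : {linear A -> C} := u \o f.

Section Kernel.
Context {R : pzRingType} {A B : lmodType R} (f : {linear A -> B}).

Definition kernel_pred : {pred A} := [pred x | f x == 0].

Fact kernel_submod : submod_closed kernel_pred.
Proof.
split=> [|a x y]; rewrite !inE ?linear0 // => /eqP fx /eqP fy.
by rewrite linearP fx fy scaler0 addr0.
Qed.

HB.instance Definition _ := GRing.isSubmodClosed.Build R A kernel_pred
  kernel_submod.

Record kernel := Kernel { kernel_val : A; _ : kernel_val \in kernel_pred }.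

HB.instance Definition _ := [isSub for kernel_val].
HB.instance Definition _ := [Choice of kernel by <:].
HB.instance Definition _ := [SubChoice_isSubLmodule of kernel by <:].

Definition kernel_incl : {linear kernel -> A} := \val.

End Kernel.

(* {malg R[A]} is the free R-module on the underlying set of A, and counit is
   the canonical surjection of it onto A. *)
Section Counit.
Context {R : nzRingType} (A : lmodType R).

Definition counit (g : {malg R[A]}) : A := \sum_(a <- msupp g) g@_a *: a.

Fact counit_wide (g : {malg R[A]}) (d : {fset A}) :
  fsubset (msupp g) d -> counit g = \sum_(a <- d) g@_a *: a.
Proof.
move=> sgd; rewrite /counit (big_fset_incl _ sgd) //= => a _ ag.
by rewrite mcoeff_outdom // scale0r.
Qed.

Fact counit_linear : linear counit.
Proof.
move=> c g h; pose d := fsetU (msupp (c *: g + h)) (fsetU (msupp g) (msupp h)).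
rewrite !(@counit_wide _ d).
- rewrite scaler_sumr -big_split; apply: eq_bigr => a _ /=.
  by rewrite mcoeffD fgscaleE scalerDl scalerA.
- by rewrite /d fsetUA; exact: fsubsetUr.
- by rewrite /d fsetUCA; exact: fsubsetUl.
- exact: fsubsetUl.
Qed.

HB.instance Definition _ := GRing.isLinear.Build R {malg R[A]} A *:%R counit
  counit_linear.

Definition syzygy : lmodType R := kernel counit.

Lemma counit_surj (a : A) : exists g, counit g = a.
Proof.
exists << a >>; rewrite (@counit_wide _ [fset a]%fset) ?msuppU_le //.
by rewrite big_seq_fset1 mcoeffUU scale1r.
Qed.

End Counit.

(* The standard free resolution
     ... -> res A 1 -> res A 0 -> A -> 0
   of A, obtained by repeatedly covering by the free module on the underlying
   set: res_diff A i is the composite of counit : res A i.+1 -> syzygy^(i+1) A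
   with the inclusion syzygy^(i+1) A -> res A i. *)
Section Ext.
Context {R : nzRingType}.

Definition res (A : lmodType R) (i : nat) : lmodType R :=
  {malg R[iter i syzygy A]}.

Definition res_diff (A : lmodType R) (i : nat) :
    {linear res A i.+1 -> res A i} :=
  hom_comp (kernel_incl (counit (A := iter i syzygy A)))
           (counit (A := iter i.+1 syzygy A)).

Lemma res_exact (A : lmodType R) (i : nat) (x : res A i.+1) :
  res_diff A i x = 0 <-> exists y, res_diff A i.+1 y = x.
Proof.
split=> [|[y <-]].
  rewrite /res_diff /= => /(@val_inj _ _ _ _ 0)/eqP x0.
  have [y Dy] := counit_surj (Kernel x0).
  by exists y; rewrite /= Dy.
have := valP (counit (A := iter i.+2 syzygy A) y).
by rewrite inE /res_diff /= => /eqP ->.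
Qed.

(* Ext^i(A, B) is the i-th cohomology group of the cochain complex
   Hom(res A 0, B) -> Hom(res A 1, B) -> ...
   The resolution lives in the category of all modules; for finitely generated
   A and B over a noetherian ring this is also the Ext of the abelian category
   of finitely generated modules. *)
Definition cocycle_pred (i : nat) (A B : lmodType R) :
    {pred {linear res A i -> B}} :=
  [pred f | hom_comp f (res_diff A i) == 0].

Fact cocycle_zmod i (A B : lmodType R) : zmod_closed (@cocycle_pred i A B).
Proof.
split=> [|f g]; rewrite !inE; first by apply/eqP/linear_ext.
move=> /eqP f0 /eqP g0; apply/eqP/linear_ext => x.
have {f0} := congr1 (fun h : {linear _ -> _} => h x) f0.
have {g0} := congr1 (fun h : {linear _ -> _} => h x) g0.
by rewrite !hom0E /= => -> ->; rewrite subrr.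
Qed.

HB.instance Definition _ i (A B : lmodType R) := GRing.isZmodClosed.Build
  {linear res A i -> B} (@cocycle_pred i A B) (@cocycle_zmod i A B).

Record cocycle (i : nat) (A B : lmodType R) := Cocycle
  { cocycle_val :> {linear res A i -> B};
    _ : cocycle_val \in @cocycle_pred i A B }.

HB.instance Definition _ i (A B : lmodType R) := [isSub for @cocycle_val i A B].
HB.instance Definition _ i (A B : lmodType R) :=
  [Choice of @cocycle i A B by <:].
HB.instance Definition _ i (A B : lmodType R) :=
  [SubChoice_isSubZmodule of @cocycle i A B by <:].

Definition is_coboundary (i : nat) (A B : lmodType R) :
    {linear res A i -> B} -> Prop :=
  match i with
  | 0 => fun f => f = 0
  | j.+1 => fun f =>
      exists h : {linear res A j -> B}, f = hom_comp h (res_diff A j)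
  end.

Definition coboundary_pred (i : nat) (A B : lmodType R) :
    {pred cocycle i A B} :=
  [pred f | `[< is_coboundary (cocycle_val f) >]].

Fact coboundary_zmod i (A B : lmodType R) :
  zmod_closed (@coboundary_pred i A B).
Proof.
case: i => [|i]; split=> [|f g]; rewrite !inE.
- exact/asboolP.
- move=> /asboolP /= f0 /asboolP /= g0; apply/asboolP.
  by rewrite /= f0 g0 subr0.
- by apply/asboolP; exists 0; exact: linear_ext.
- move=> /asboolP /= [h Dh] /asboolP /= [k Dk]; apply/asboolP.
  by exists (h - k); rewrite /= Dh Dk; exact: linear_ext.
Qed.

HB.instance Definition _ i (A B : lmodType R) := GRing.isZmodClosed.Build
  (cocycle i A B) (@coboundary_pred i A B) (@coboundary_zmod i A B).

Definition Ext (i : nat) (A B : lmodType R) : zmodType :=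
  Quotient.quot (@coboundary_pred i A B).

Definition Ext_class (i : nat) (A B : lmodType R) (f : cocycle i A B) :
  Ext i A B := \pi f.

Lemma Ext_class_eq i (A B : lmodType R) (f g : cocycle i A B) :
  Ext_class f = Ext_class g <->
  is_coboundary (cocycle_val f - cocycle_val g).
Proof.
rewrite /Ext_class; split=> [/eqP | fg].
  by rewrite -Quotient.idealrBE inE => /asboolP.
by apply/eqP; rewrite -Quotient.idealrBE inE; apply/asboolP.
Qed.

Lemma Ext_class0 i (A B : lmodType R) : Ext_class (0 : cocycle i A B) = 0.
Proof. by rewrite /Ext_class !piE. Qed.

Lemma Ext_classB i (A B : lmodType R) (f g : cocycle i A B) :
  Ext_class (f - g) = Ext_class f - Ext_class g.
Proof. by rewrite /Ext_class !piE. Qed.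

Lemma Ext_classP i (A B : lmodType R) (e : Ext i A B) :
  exists f, e = Ext_class f.
Proof. by exists (repr e); rewrite /Ext_class reprK. Qed.

Section Functoriality.
Variables (i : nat) (A B C : lmodType R) (u : {linear B -> C}).

Fact cocycle_map_proof (f : cocycle i A B) :
  hom_comp u (cocycle_val f) \in @cocycle_pred i A C.
Proof.
have := valP f; rewrite !inE => /eqP f0; apply/eqP/linear_ext => x /=.
have {f0} := congr1 (fun h : {linear _ -> _} => h x) f0.
by rewrite hom0E /= => ->; rewrite linear0.
Qed.

Definition cocycle_map (f : cocycle i A B) : cocycle i A C :=
  Cocycle (cocycle_map_proof f).

(* The representative is irrelevant, see Ext_mapE. *)
Definition Ext_map (e : Ext i A B) : Ext i A C :=
  Ext_class (cocycle_map (repr e)).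

Fact coboundary_comp (f : {linear res A i -> B}) :
  is_coboundary f -> is_coboundary (hom_comp u f).
Proof.
case: (i) f => [|j] f /= => [->|[h ->]].
  by apply: linear_ext => x; apply: linear0.
by exists (hom_comp u h); apply: linear_ext.
Qed.

Lemma Ext_mapE (f : cocycle i A B) :
  Ext_map (Ext_class f) = Ext_class (cocycle_map f).
Proof.
have /Ext_class_eq/coboundary_comp D : Ext_class (repr (Ext_class f)) =
  Ext_class f by rewrite /Ext_class reprK.
apply/Ext_class_eq => /=.
set w := (X in is_coboundary X); set v := (X in is_coboundary X) in D.
suff -> : w = v by [].
by apply: linear_ext => x; rewrite /w /v /= raddfB.
Qed.

Fact Ext_map_zmod : zmod_morphism Ext_map.
Proof.
move=> e e'; have [[f ->] [g ->]] := (Ext_classP e, Ext_classP e').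
rewrite -Ext_classB !Ext_mapE -Ext_classB; congr Ext_class.
by apply/val_inj/linear_ext => x; rewrite /= raddfB.
Qed.

HB.instance Definition _ :=
  GRing.isZmodMorphism.Build (Ext i A B) (Ext i A C) Ext_map Ext_map_zmod.

End Functoriality.

End Ext.

Record fgmod (R : pzRingType) := FGMod
  { fgmod_sort :> lmodType R; _ : finitely_generated fgmod_sort }.

(* A sequence ... -> c 2 -> c 1 -> c 0 of arbitrary morphisms. A finite sequence
   of N modules is encoded by the terms c 0, ..., c N.-1, the others being
   irrelevant. *)
Record chain (R : pzRingType) := Chain
  { chain_ob :> nat -> fgmod R;
    chain_map : forall i, {linear chain_ob i.+1 -> chain_ob i} }.

(* ... -> c 1 -> c 0 -> a *)
Definition chain_cons_ob (R : pzRingType) (a : fgmod R) (c : chain R) (i : nat)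
  : fgmod R := if i is j.+1 then c j else a.

Definition chain_cons (R : pzRingType) (a : fgmod R) (c : chain R)
    (f : {linear c 0%N -> a}) : chain R :=
  @Chain R (chain_cons_ob a c)
    (fun i => match i return
         {linear chain_cons_ob a c i.+1 -> chain_cons_ob a c i} with
       | 0 => f
       | j.+1 => chain_map c j
       end).

(* Exactness at position i < N of
     0 -> G N.-1 -> ... -> G 1 -> G 0 -> 0. *)
Definition exact_at (G : nat -> zmodType) (d : forall i, G i.+1 -> G i)
    (N i : nat) : Prop :=
  forall y : G i,
    (match i return G i -> Prop with
     | 0 => fun _ => True
     | j.+1 => fun y => d j y = 0
     end) y
    <-> (if (i.+1 < N)%N then exists z, d i z = y else y = 0).

Definition exact_pair (A B C : zmodType) (f : A -> B) (g : B -> C) : Prop :=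
  forall y, g y = 0 <-> exists x, f x = y.

Section Subcategories.
Context {R : nzRingType}.
Implicit Types (M X : fgmod R -> Prop) (a b m x : fgmod R) (c : chain R).

Definition surjective_map (A B : lmodType R) (f : {linear A -> B}) : Prop :=
  forall z, exists y, f y = z.

Definition is_iso (A B : lmodType R) (f : {linear A -> B}) : Prop :=
  exists g : {linear B -> A}, cancel f g /\ cancel g f.

Definition is_precover X x m (f : {linear x -> m}) : Prop :=
  X x /\ forall x', X x' -> forall g : {linear x' -> m},
    exists h : {linear x' -> x}, f \o h =1 g.

Definition is_preenvelope X m x (f : {linear m -> x}) : Prop :=
  X x /\ forall x', X x' -> forall g : {linear m -> x'},
    exists h : {linear x -> x'}, h \o f =1 g.

Definition is_cover X x m (f : {linear x -> m}) : Prop :=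
  is_precover X f /\ forall p : {linear x -> x}, f \o p =1 f -> is_iso p.

Definition functorially_finite M : Prop := forall a,
  (exists m, exists f : {linear m -> a}, is_precover M f) /\
  (exists m, exists f : {linear a -> m}, is_preenvelope M f).

Definition generating M : Prop := forall a,
  exists2 m, M m & exists f : {linear m -> a}, surjective_map f.

Definition cogenerating M : Prop := forall a,
  exists2 m, M m & exists f : {linear a -> m}, injective f.

Definition additive_subcategory M : Prop :=
  (exists2 z, M z & forall y : z, y = 0) /\
  (forall a b, M a -> M b ->
    exists2 s, M s & exists f : {linear s -> (a * b)%type}, is_iso f).

Definition cluster_tilting (n : nat) M : Prop :=
  [/\ additive_subcategory M, functorially_finite M,
      generating M /\ cogenerating M,
      forall a, M a <-> (forall m, M m -> forall i, (0 < i < n)%N ->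
                           forall e : Ext i m a, e = 0)
    & forall a, M a <-> (forall m, M m -> forall i, (0 < i < n)%N ->
                           forall e : Ext i a m, e = 0)].

(* 0 -> c n.+1 -> c n -> ... -> c 1 -> c 0 -> 0 *)
Definition n_exact (n : nat) M c : Prop :=
  (forall i, (i < n.+2)%N -> M (c i)) /\
  (forall i, (i < n.+2)%N -> exact_at (chain_map c) n.+2 i).

Definition Hom_map m c (i : nat) :
    {linear m -> c i.+1} -> {linear m -> c i} := hom_comp (chain_map c i).

Definition Ext_chain_map (j : nat) m c (i : nat) :
    Ext j m (c i.+1) -> Ext j m (c i) := Ext_map (chain_map c i).

(* The sequence
     0 -> Hom(m, c n.+1) -> ... -> Hom(m, c 0)
       -> Ext^n(m, c n.+1) -> ... -> Ext^n(m, c 0)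
       -> Ext^(2n)(m, c n.+1) -> ...
   with connecting maps d0 and d 1, d 2, ... *)
Definition long_exact_sequence (n : nat) m c : Prop :=
  exists (d0 : {additive {linear m -> c 0%N} -> Ext (1 * n) m (c n.+1)})
         (d : forall j, {additive Ext (j * n) m (c 0%N) ->
                                  Ext (j.+1 * n) m (c n.+1)}),
  [/\ forall i, (0 < i < n.+2)%N -> exact_at (@Hom_map m c) n.+2 i,
      exact_pair (@Hom_map m c 0) d0,
      exact_pair d0 (@Ext_chain_map (1 * n) m c n)
    & forall j, (0 < j)%N ->
      [/\ forall i, (0 < i < n.+1)%N ->
            exact_at (@Ext_chain_map (j * n) m c) n.+2 i,
          exact_pair (@Ext_chain_map (j * n) m c 0) (d j)
        & exact_pair (d j) (@Ext_chain_map (j.+1 * n) m c n)]].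

Definition nZ_cluster_tilting (n : nat) M : Prop :=
  cluster_tilting n M /\
  forall m c, M m -> n_exact n M c -> long_exact_sequence n m c.

(* The n-kernel k_n -> ... -> k_1 -> x of f : x -> m is given by a chain k with
   k_(i+1) = k i together with the map g : k_1 -> x. *)
Definition n_kernel (n : nat) M x m (f : {linear x -> m}) (k : chain R)
    (g : {linear k 0%N -> x}) : Prop :=
  (forall i, (i < n)%N -> M (k i)) /\
  forall m', M m' -> forall i, (0 < i < n.+2)%N ->
    exact_at (@Hom_map m' (@chain_cons R m (chain_cons g) f)) n.+2 i.

Definition radical a b (f : {linear a -> b}) : Prop :=
  forall g : {linear b -> a}, is_iso (idfun \- (g \o f)).

Definition almost_minimal (n : nat) c : Prop :=
  forall i, (1 < i.+1 <= n)%N -> radical (chain_map c i).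

Definition left_closed_under_extensions (n : nat) M X : Prop :=
  forall c, n_exact n M c -> almost_minimal n c ->
    X (c n.+1) -> X (c 0%N) -> X (c n).

End Subcategories.

(* Main.v *)
Require Import Defs.
From HB Require Import structures.
From mathcomp Require Import all_boot all_order all_algebra.
From mathcomp Require Import boolp classical_sets.
From mathcomp Require Import finmap monalg.

Set Implicit Arguments.
Unset Strict Implicit.
Unset Printing Implicit Defensive.

Import GRing.Theory.
Local Open Scope ring_scope.
Local Open Scope quotient_scope.

(** The sequence 0 -> k_n -> ... -> k_1 -> x -> m -> 0 is n-exact, and
    Hom(x', x) -> Hom(x', m) is onto, so the long exact sequence reduces the
    theorem to the vanishing of Ext^n(x', k_1) -> Ext^n(x', x). Let eta be in its
    image. Pushing out a projective resolution of x' gives a monomorphism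
    x -> E killing eta to which f extends, because f kills k_1 -> x; composing it
    with a left M-approximation of E, one may replace E by an object of M. The
    cokernel of the resulting x -> m_n is then resolved backwards towards x' by
    pullbacks along right M-approximations, which yields an n-exact sequence
    0 -> x -> x_n -> ... -> x_1 -> x' -> 0 such that x -> x_n kills eta and f still
    extends to x_n. Splitting off contractible summands, which is possible since
    all modules have finite length, makes it almost minimal, whence x_n is in X.
    The extension of f to x_n factors through f, so x -> x_n is a split
    monomorphism by the minimality of f, and eta = 0. *)

(** * Strict steps of ascending chains *)

Definition ascending T (U : nat -> T -> Prop) : Prop :=
  forall i y, U i y -> U i.+1 y.

Definition jump T (U : nat -> T -> Prop) (i : nat) : Prop :=
  exists2 y, U i.+1 y & ~ U i y.

(** A bound on this number, uniform in [r] and in the chain [U] of submodules, is how finite length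
    is expressed throughout. *)
Definition jumps T (U : nat -> T -> Prop) (r : nat) : nat :=
  \sum_(i < r) `[< jump U i >].

Lemma nojump T (U : nat -> T -> Prop) i y : ~ jump U i -> U i.+1 y -> U i y.
Proof. by move=> nj Uy; apply: contrapT => nU; apply: nj; exists y. Qed.

Lemma jumps_le T T' (U : nat -> T -> Prop) (V : nat -> T' -> Prop) r :
  (forall i, jump U i -> jump V i) -> (jumps U r <= jumps V r)%N.
Proof.
move=> UV; apply: leq_sum => i _.
by case: asboolP => // /UV Vi; case: asboolP.
Qed.

Lemma jumps_eq T (U : nat -> T -> Prop) r :
  (forall i, (i < r)%N -> jump U i) -> jumps U r = r.
Proof.
move=> Uj; rewrite -[RHS]card_ord -sum1_card.
by apply: eq_bigr => i _; case: asboolP => // /(_ (Uj _ _)) [].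
Qed.

Lemma jumps_stationary T (U : nat -> T -> Prop) N :
  (forall r, (jumps U r <= N)%N) -> exists i, ~ jump U i.
Proof.
move=> UN; apply: contrapT => nj; have := UN N.+1.
rewrite jumps_eq ?ltnn // => i _; apply: contrapT => ni.
by apply: nj; exists i.
Qed.

(** * Commutative artinian rings have finite length *)

Section ArtinianRing.
Context {k : comNzRingType}.
Context (artk : artinian k).
Implicit Types I J T : k -> Prop.

Lemma idealN I x : ideal I -> I x -> I (- x).
Proof. by case=> _ _ IM Ix; rewrite -mulN1r; apply: IM. Qed.

Lemma idealB I x y : ideal I -> I x -> I y -> I (x - y).
Proof. by move=> Ii Ix Iy; case: (Ii) => _ ID _; apply: ID => //; apply: idealN. Qed.

(** If no member of [P] were minimal, iterating a choice of strictly smaller members would violate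
    the descending chain condition. *)
Lemma artinian_min (P : (k -> Prop) -> Prop) I0 :
  (forall I, P I -> ideal I) -> P I0 ->
  exists2 I, P I & forall J, P J -> (forall x, J x -> I x) ->
    forall x, I x -> J x.
Proof.
move=> Pid PI0; apply: contrapT => nomin.
have next (S : {I | P I}) : exists S' : {I | P I},
    (forall x, sval S' x -> sval S x) /\ exists2 x, sval S x & ~ sval S' x.
  case: S => I PI /=; apply: contrapT => noS; apply: nomin.
  exists I => // J PJ JI x Ix; apply: contrapT => nJx; apply: noS.
  by exists (exist _ J PJ); split=> //; exists x.
have [F FP] := choice next.
pose S i := iter i F (exist _ I0 PI0).
have [N /(_ N.+1 (leqnSn N)) SN] := artk (fun i => Pid _ (svalP (S i)))
  (fun i => (FP (S i)).1).
by have [x Sx nSx] := (FP (S N)).2; apply: nSx; apply: SN.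
Qed.

(** For an ideal [I]: the quotient [k / I] has length at most [N], read off from chains of ideals
    above [I] without forming the quotient. *)
Definition len_above I N := forall U : nat -> k -> Prop,
  (forall i, ideal (U i)) -> ascending U -> (forall y, I y -> U 0%N y) ->
  forall r, (jumps U r <= N)%N.

Definition maximal_sub T I : Prop :=
  [/\ forall x, T x -> I x, exists2 x, I x & ~ T x &
      forall U, ideal U -> (forall x, T x -> U x) -> (forall x, U x -> I x) ->
        (exists2 x, U x & ~ T x) -> forall x, I x -> U x].

(** A strict step of [U] stays strict either in the sums [U i + I] or in the intersections of [U i]
    with [I]. The sums lie above [I] and jump at most [N] times; the intersections lie between [T]
    and [I], where there is room for one jump only. *)
Lemma len_above_maximal_sub T I N : ideal T -> ideal I ->
  maximal_sub T I -> len_above I N -> len_above T N.+1.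
Proof.
move=> [T0 TD TM] idI [TI _ Tmax] lenI U idU ascU TU r.
have idcap i : ideal (fun y => U i y /\ I y).
  case: (idU i) idI => U0 UD UM [I0 ID IM].
  by split=> // [x y [? ?] [? ?]|a x [? ?]]; split; auto.
have idsum i : ideal (fun y => exists u v, [/\ U i u, I v & y = u + v]).
  case: (idU i) idI => U0 UD UM [I0 ID IM]; split.
  - by exists 0, 0; rewrite addr0.
  - move=> _ _ [u [v [? ? ->]]] [u' [v' [? ? ->]]].
    by exists (u + u'), (v + v'); rewrite addrACA; split; auto.
  - move=> a _ [u [v [? ? ->]]]; exists (a * u), (a * v).
    by rewrite mulrDr; split; auto.
pose V1 i y := U i y /\ I y.
pose V2 i y := exists u v, [/\ U i u, I v & y = u + v].
have J12 i : jump U i -> jump V1 i \/ jump V2 i.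
  move=> [y Uy nUy]; case: (pselect (V2 i y)) => [[u [v [Uu Iv Dy]]]|nV]; last first.
    right; exists y => //; exists y, 0; rewrite addr0; split=> //.
    by case: idI.
  left; exists v; last first.
    move=> [Uv _]; apply: nUy; rewrite Dy.
    by case: (idU i) => _ UD _; apply: UD.
  split=> //; have -> : v = y - u by rewrite Dy addrC addKr.
  by apply: idealB => //; apply: ascU.
apply: (@leq_trans (jumps V1 r + jumps V2 r)).
  rewrite /jumps -big_split; apply: leq_sum => i _ /=.
  by case: asboolP => // /J12 [] Vi; do 2!case: asboolP => //.
rewrite -add1n leq_add //; last first.
  apply: lenI => // [i _ [u [v [Uu Iv ->]]]|y Iy].
    by exists u, v; split=> //; apply: ascU.
  by exists 0, y; rewrite add0r; split=> //; case: (idU 0%N).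
have V1T i y : T y -> V1 i y.
  move=> Ty; split; last exact: TI.
  by elim: i => [|i /ascU //]; apply: TU.
(* After a jump at [i] the intersection contains [T] strictly, so by maximality it equals [I] from
   then on. *)
have jump_all i j : jump V1 i -> (i < j)%N -> ~ jump V1 j.
  move=> [y V1y nV1y] ij [z [_ Iz] []]; split=> //.
  suff: V1 j z by case.
  apply: (Tmax (V1 j)); [exact: idcap|exact: V1T|by move=> x []| |by []].
  exists y; last by move/(V1T i).
  case: V1y => Uy Iy; split=> //.
  by elim: j ij => // j IH; rewrite ltnS leq_eqVlt => /orP [/eqP <- //|/IH/ascU].
elim: r => [|r IHr]; first by rewrite /jumps big_ord0.
rewrite /jumps big_ord_recr /= -/(jumps V1 r).
case: asboolP => [jr|_]; last by rewrite addn0.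
rewrite /jumps big1 // => i _; case: asboolP => // ji.
by case: (jump_all _ _ ji (ltn_ord i)).
Qed.

(** Otherwise take [J] minimal among the nonzero ideals without a maximal subideal. Every element of
    [k] acts on [J] as zero or invertibly, so [J] behaves like a vector space, and a subspace
    maximal among those avoiding a fixed nonzero [t] is a maximal subideal after all. *)
Lemma ideal_has_maximal_sub I : ideal I -> (exists2 x, I x & x <> 0) ->
  exists2 T, ideal T & maximal_sub T I.
Proof.
move=> idI nzI; apply: contrapT => nomax.
pose P J := [/\ ideal J, exists2 x, J x & x <> 0 &
                ~ exists2 T, ideal T & maximal_sub T J].
have [J [idJ [t Jt tn0] nomaxJ] Jmin] : exists2 J, P J & forall J', P J' ->
    (forall x, J' x -> J x) -> forall x, J x -> J' x.
  by apply: (@artinian_min P I) => [? []|].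
have JM a y : J y -> J (a * y) by case: idJ => _ _; apply.
(* Multiplication by [a] maps [J] onto [0] or onto an ideal with the same
   properties, hence onto [J]. *)
have aJ a : (forall y, J y -> a * y = 0) \/
            (forall y, J y -> exists2 z, J z & y = a * z).
  case: (pselect (exists2 y, J y & a * y <> 0)) => [[y Jy ay]|n0]; last first.
    by left=> y Jy; apply: contrapT => ay; apply: n0; exists y.
  right; apply: (Jmin (fun y => exists2 z, J z & y = a * z)); last first.
    by move=> _ [z Jz ->]; apply: JM.
  case: (idJ) => J0 JD _; split.
  - split=> [|_ _ [u Ju ->] [v Jv ->]|b _ [u Ju ->]].
    + by exists 0; rewrite ?mulr0.
    + by exists (u + v); rewrite ?mulrDr //; apply: JD.
    + by exists (b * u); rewrite 1?mulrCA //; apply: JM.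
  - by exists (a * y) => //; exists y.
  (* A maximal subideal [T] of [a J] would pull back under multiplication by [a] to a maximal
     subideal of [J]. *)
  - move=> [T idT [TaJ [_ [z Jz ->] nT] Tmax]]; apply: nomaxJ.
    have idT' : ideal (fun y => J y /\ T (a * y)).
      case: (idT) => T0 TD TM; split; first by rewrite mulr0.
      + move=> u v [? ?] [? ?]; rewrite mulrDr.
        by split; [apply: JD|apply: TD].
      + move=> b u [? ?]; rewrite mulrCA.
        by split; [apply: JM|apply: TM].
    exists (fun y => J y /\ T (a * y)) => //; split.
    + by move=> ? [].
    + by exists z => // -[].
    + move=> U idU TU UJ [w Uw nw] v Jv.
      have [|||||u Uu Du] := Tmax (fun y => exists2 u, U u & y = a * u)
        _ _ _ _ (a * v).
      * case: (idU) => U0 UD UM; split=> [|_ _ [? ? ->] [? ? ->]|b _ [? ? ->]].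
        - by exists 0; rewrite ?mulr0.
        - by eexists; last rewrite -mulrDr //; apply: UD.
        - by eexists; last rewrite mulrCA //; apply: UM.
      * move=> s Ts; have [u Ju Ds] := TaJ _ Ts.
        by exists u => //; apply: TU; rewrite -Ds.
      * by move=> _ [u /UJ Ju ->]; exists u.
      * exists (a * w); first by exists w.
        by move=> Taw; apply: nw; split=> //; apply: UJ.
      * by exists v.
      * have -> : v = u + (v - u) by rewrite addrC subrK.
        case: (idU) => _ UD _; apply: UD => //; apply: TU.
        rewrite mulrBr Du subrr; split; last by case: idT.
        by apply: idealB => //; apply: UJ.
(* So [k / ann J] is a field and [J] is a vector space over it. *)
have inv a : (exists2 y, J y & a * y <> 0) ->
    exists b, forall y, J y -> b * (a * y) = y.
  move=> [y0 Jy0 ay0].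
  have aonto y : J y -> exists2 z, J z & y = a * z.
    by case: (aJ a) => [a0|]; [case: ay0; apply: a0|apply].
  have anonto n y : J y -> exists2 z, J z & y = a ^+ n * z.
    elim: n y => [|n IH] y Jy; first by exists y; rewrite // expr0 mul1r.
    have [z Jz ->] := aonto _ Jy; have [w Jw ->] := IH _ Jz.
    by exists w; rewrite // exprS mulrA.
  (* The ideals generated by the powers of [a] become stationary, so [a ^+ n = a ^+ n.+1 * b] for
     some [b]; as [a ^+ n] maps [J] onto itself, [b] inverts [a] on [J]. *)
  have [||n /(_ n.+1 (leqnSn n) (a ^+ n)) [|b Db]] :=
      artk (I := fun n x => exists b, x = a ^+ n * b).
  - move=> n; split=> [|_ _ [b ->] [c ->]|c _ [b ->]].
    + by exists 0; rewrite mulr0.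
    + by exists (b + c); rewrite mulrDr.
    + by exists (c * b); rewrite mulrCA.
  - by move=> n _ [b ->]; exists (a * b); rewrite mulrA -exprSr.
  - by exists 1; rewrite mulr1.
  - exists b => y /(anonto n) [z Jz ->].
    by rewrite [RHS](congr1 ( *%R^~ z) Db) (mulrA a) -exprS mulrCA mulrA.
(* [A 0] is left out of [Q] so that the union of the empty chain qualifies in Zorn's lemma. It
   follows from maximality: without 0 the set [A] is empty, and the zero ideal is larger. *)
pose Q (A : set k) := [/\ forall y, A y -> J y, ~ A t,
  forall x y, A x -> A y -> A (x + y) & forall a x, A x -> A (a * x)].
have [A [[AJ nAt AD AM] Amax]] : exists A, Q A /\ forall B, (A `<` B)%classic -> ~ Q B.
  apply: Zorn_bigcup => F FQ totF; split.
  - by move=> y [X FX Xy]; case: (FQ _ FX) => XJ _ _ _; apply: XJ.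
  - by move=> [X FX Xt]; case: (FQ _ FX) => _ /(_ Xt).
  - move=> x y [X FX Xx] [Y FY Yy].
    have [XY|YX] := totF _ _ FX FY.
    + by exists Y => //; case: (FQ _ FY) => _ _ YD _; apply: YD => //; apply: XY.
    + by exists X => //; case: (FQ _ FX) => _ _ XD _; apply: XD => //; apply: YX.
  - by move=> a x [X FX Xx]; exists X => //; case: (FQ _ FX) => _ _ _; apply.
have A0 : A 0.
  apply: contrapT => nA0; apply: (Amax (fun y => y = 0)); last first.
    case: (idJ) => J0 _ _; split=> [_ ->|/tn0|_ _ -> ->|a _ ->] //.
    - by rewrite addr0.
    - by rewrite mulr0.
  split=> [y Ay|/(_ 0 erefl) //].
  by case: nA0; rewrite -(mul0r y); apply: AM.
have idA : ideal A by [].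
apply: nomaxJ; exists A => //; split=> //; first by exists t.
move=> U idU AU UJ [w Uw nAw] s Js; have [_ UD UM] := idU.
have reach B : ideal B -> (forall y, A y -> B y) -> (forall y, B y -> J y) ->
    (exists2 y, B y & ~ A y) -> B t.
  move=> [_ BD BM] AB BJ [y By nAy]; apply: contrapT => nBt.
  apply: (Amax B); first by split=> // /(_ y By).
  by split.
have Ut := reach U idU AU UJ (ex_intro2 _ _ w Uw nAw).
case: (pselect (A s)) => [/AU //|nAs].
(* The ideal [A + k s] is larger than [A], hence contains [t]. Solving [t = a' + c * s] for [s],
   with [c] invertible on [J], puts [s] into [U]. *)
have [||||c [a' Aa' Dt]] := reach (fun y => exists c, exists2 a, A a & y = a + c * s).
- split=> [|_ _ [c [a Aa ->]] [c' [a' Aa' ->]]|b _ [c [a Aa ->]]].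
  + by exists 0, 0; rewrite // mul0r addr0.
  + by exists (c + c'), (a + a'); [exact: AD|rewrite mulrDl addrACA].
  + by exists (b * c), (b * a); [exact: AM|rewrite mulrDr mulrA].
- by move=> y Ay; exists 0, y; rewrite // mul0r addr0.
- by case: (idJ) => _ JD _ _ [c [a /AJ Ja ->]]; apply/JD/JM.
- by exists s => //; exists 1, 0; rewrite // add0r mul1r.
have [|b binv] := inv c.
  exists s => // cs0; apply: nAt; rewrite Dt cs0 addr0 //.
rewrite -(binv s) //; apply: UM.
have -> : c * s = t - a' by rewrite Dt addrC addKr.
by apply: idealB => //; apply: AU.
Qed.

(** An ideal minimal among those of finite colength is zero, since a maximal subideal of it would
    again have finite colength. *)
Lemma artinian_len : exists N, len_above (fun x => x = 0) N.
Proof.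
pose P I := ideal I /\ exists N, len_above I N.
have [I [idI [N lenI]] Imin] : exists2 I, P I & forall J, P J ->
    (forall x, J x -> I x) -> forall x, I x -> J x.
  apply: (@artinian_min P (fun=> True)) => [? []|] //.
  split=> //; exists 0%N => U _ ascU U0 r.
  rewrite leqn0 /jumps; apply/eqP; apply: big1 => i _.
  case: asboolP => // -[y _ []].
  by elim: {i} (i : nat) => [|i /ascU //]; apply: U0.
exists N; case: (pselect (exists2 x, I x & x <> 0)) => [nzI|z]; last first.
  move=> U idU ascU U0 r; apply: lenI => // y Iy; apply: U0.
  by apply: contrapT => y0; apply: z; exists y.
have [T idT maxT] := ideal_has_maximal_sub idI nzI.
case: (maxT) => TI [x Ix nTx] _; case: nTx.
by apply: (Imin T) => //; split=> //; exists N.+1; apply: len_above_maximal_sub maxT lenI.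
Qed.

End ArtinianRing.

(** * Finite length of modules over an Artin algebra *)

Definition submodule (R : pzRingType) (A : lmodType R) (S : A -> Prop) : Prop :=
  S 0 /\ forall c x y, S x -> S y -> S (c *: x + y).

Definition len_le (R : pzRingType) (A : lmodType R) (N : nat) : Prop :=
  forall U : nat -> A -> Prop, (forall i, submodule (U i)) -> ascending U ->
    forall r, (jumps U r <= N)%N.

Section Submodule.
Context {R : pzRingType} {A : lmodType R} (S : A -> Prop).
Context (subS : submodule S).

Lemma submodule0 : S 0. Proof. by case: subS. Qed.

Lemma submoduleD x y : S x -> S y -> S (x + y).
Proof. by case: subS => _ SP Sx Sy; rewrite -(scale1r x); apply: SP. Qed.

Lemma submoduleZ c x : S x -> S (c *: x).
Proof. by case: subS => S0 SP Sx; rewrite -(addr0 (c *: x)); apply: SP. Qed.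

Lemma submoduleN x : S x -> S (- x).
Proof. by rewrite -scaleN1r; apply: submoduleZ. Qed.

Lemma submoduleB x y : S x -> S y -> S (x - y).
Proof. by move=> Sx Sy; apply/submoduleD/submoduleN. Qed.

End Submodule.

Section ArtinAlgebra.
Context {k : comNzRingType} {L : algType k}.
Context (artinL : artin_algebra L).

(** Restriction of scalars from [L^c] to [k] runs along this map. *)
Definition central (c : k) : L^c := (c%:A : L).

Lemma centralD c d : central (c + d) = central c + central d.
Proof. exact: scalerDl. Qed.

Lemma centralM c d : central (c * d) = central c * central d.
Proof.
rewrite /central; change ((c * d)%:A = d%:A * c%:A :> L).
by rewrite -scalerAl mul1r scalerA mulrC.
Qed.

Section Module.
Context {A : lmodType L^c}.
Implicit Types (s : seq A) (x y : A).

(** The [k]-span, in a recursive form that removes one generator at a time for the induction in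
    [kspan_len]. *)
Fixpoint kspan s x : Prop :=
  if s is b :: s' then exists c, kspan s' (x - central c *: b) else x = 0.

Lemma kspanP s a x y : kspan s x -> kspan s y ->
  kspan s (central a *: x + y).
Proof.
elim: s x y => [|b s IH] x y /=; first by move=> -> ->; rewrite scaler0 addr0.
move=> [c sx] [d sy]; exists (a * c + d); have := IH _ _ sx sy.
by rewrite scalerBr addrACA -opprD scalerA -centralM -scalerDl -centralD.
Qed.

Lemma kspan0 s : kspan s 0.
Proof.
elim: s => //= b s IH; exists 0; rewrite sub0r.
by rewrite /central scale0r scale0r oppr0.
Qed.

Lemma kspanD s x y : kspan s x -> kspan s y -> kspan s (x + y).
Proof.
by move=> sx sy; have := kspanP 1 sx sy; rewrite /central !scale1r.
Qed.

Lemma kspan_mem s c b : b \in s -> kspan s (central c *: b).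
Proof.
elim: s => //= b' s IH; rewrite inE => /predU1P [->|/IH sb].
  by exists c; rewrite subrr; apply: kspan0.
by exists 0; rewrite /central !scale0r subr0.
Qed.

Lemma kspan_sum s (I : Type) (r : seq I) (F : I -> A) :
  (forall i, kspan s (F i)) -> kspan s (\sum_(i <- r) F i).
Proof.
by move=> sF; elim/big_rec: _ => [|i x _]; [apply: kspan0|apply: kspanD].
Qed.

(** A strict step inside the span of [b :: s] is strict inside the span of [s] or in the ideals
    [V i] of those coefficients of [b] that occur in [U i] modulo that span. Each generator
    therefore adds at most [N] steps. *)
Lemma kspan_len N s (U : nat -> A -> Prop) r :
    len_above (fun x : k => x = 0) N ->
  (forall i, submodule (U i)) -> ascending U ->
  (jumps (fun i x => U i x /\ kspan s x) r <= size s * N)%N.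
Proof.
move=> lenk subU ascU; elim: s => [|b s IH] /=.
  rewrite mul0n leqn0; apply/eqP; apply: big1 => i _.
  case: asboolP => // -[y [_ /= ->] []]; split=> //; exact: submodule0 (subU i).
pose V i c := exists2 x, kspan s x & U i (central c *: b + x).
have sub1 x y : kspan s x -> kspan s y -> kspan s (x - y).
  move=> sx sy; have := kspanP (-1) sy sx.
  by rewrite /central scaleN1r scaleN1r addrC.
have idV i : ideal (V i).
  split.
  - exists 0; first exact: kspan0.
    rewrite /central !scale0r addr0; exact: submodule0 (subU i).
  - move=> c d [x sx Ux] [y sy Uy]; exists (x + y); first exact: kspanD.
    by rewrite centralD scalerDl addrACA; apply: submoduleD.
  - move=> a c [x sx Ux]; exists (central a *: x).
      by rewrite -[_ *: x]addr0; apply/kspanP/kspan0.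
    by rewrite centralM -scalerA -scalerDr; apply: submoduleZ.
rewrite mulSn addnC; apply: leq_trans (leq_add IH (lenk V idV _ _ r)).
- rewrite /jumps -big_split; apply: leq_sum => i _ /=.
  case: asboolP => // -[y [Uy [c sy]] nUy].
  case: (asboolP (jump V i)) => [_|nV]; first by rewrite addn1.
  case: asboolP => // -[]; case: (pselect (V i c)) => [[x sx Ux]|nVc].
    exists (y - (central c *: b + x)); last first.
      move=> [Uyx _]; apply: nUy; split; last by exists c.
      by rewrite -(subrK (central c *: b + x) y); apply: submoduleD.
    split; first by apply: submoduleB => //; apply: ascU.
    by rewrite opprD addrA; apply: sub1.
  case: nV; exists c => //; exists (y - central c *: b) => //.
  by rewrite addrC subrK.
- by move=> i c [x sx Ux]; exists x => //; apply: ascU.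
- by move=> c ->; exact: (let: And3 V0 _ _ := idV 0%N in V0).
Qed.

End Module.

(** Products of generators of [L] over [k] with generators of [A] over [L^c] generate [A] over [k],
    so [kspan_len] bounds all chains. *)
Lemma artin_algebra_len (A : fgmod L^c) : exists N, len_le A N.
Proof.
case: A => A [s sA] /=; case: artinL => artk [t tL].
have [N lenk] := artinian_len artk.
pose u := [seq (y : L^c) *: a | a <- s, y <- t : seq L].
have uA x : kspan u x.
  have [c ->] := sA x; apply: kspan_sum => i.
  have [d Dd] := tL (c i); rewrite [c i]Dd scaler_suml.
  apply: kspan_sum => j.
  have -> : (d j *: t`_j : L^c) = central (d j) * (t`_j : L^c).
    by change (d j *: t`_j = t`_j * (d j)%:A :> L); rewrite mulr_algr.
  rewrite -scalerA; apply: kspan_mem.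
  by apply: (@allpairs_f _ _ _ (fun a (y : L) => (y : L^c) *: a)); apply: mem_nth.
exists (size u * N)%N => U subU ascU r.
apply: leq_trans (kspan_len u r lenk subU ascU).
by apply: jumps_le => i [y Uy nUy]; exists y => [//|[]].
Qed.

End ArtinAlgebra.

(** * Linear maps, kernels and projectivity *)

Section Linear.
Context {R : nzRingType}.
Implicit Types A B C : lmodType R.

Lemma exists_linear A B (h : A -> B) :
  linear h -> exists f : {linear A -> B}, forall x, f x = h x.
Proof.
move=> hl; pose hL := GRing.isLinear.Build R A B *:%R h hl.
pose f : {linear A -> B} := HB.pack h hL.
by exists f.
Qed.

(** The hypotheses make [T] single-valued: two values at one point differ by a value at 0. Any
    choice of values is thus forced to be linear. *)
Lemma linear_choice A B (T : A -> B -> Prop) :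
    (forall x, exists y, T x y) -> (forall y, T 0 y -> y = 0) ->
    (forall c x x' y y', T x y -> T x' y' -> T (c *: x + x') (c *: y + y')) ->
  exists h : {linear A -> B}, forall x, T x (h x).
Proof.
move=> /choice [h Th] T0 TP; have [|f fE] := @exists_linear A B h.
  move=> c x y; apply/eqP; rewrite -subr_eq0; apply/eqP/T0.
  have := TP (-1) _ _ _ _ (TP c _ _ _ _ (Th x) (Th y)) (Th (c *: x + y)).
  by rewrite !scaleN1r addNr [- _ + _]addrC.
by exists f => x; rewrite fE.
Qed.


Lemma factor_inj A B C (i : {linear B -> C}) (f : {linear A -> C}) :
  injective i -> (forall x, exists y, i y = f x) ->
  exists h : {linear A -> B}, forall x, i (h x) = f x.
Proof.
move=> inji fi; apply: (@linear_choice A B (fun x y => i y = f x)) => //.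
- by move=> y; rewrite linear0 => iy; apply: inji; rewrite iy linear0.
- by move=> c x x' y y' Dy Dy'; rewrite !linearP Dy Dy'.
Qed.

Lemma factor_surj A B C (q : {linear A -> C}) (f : {linear A -> B}) :
  surjective_map q -> (forall x, q x = 0 -> f x = 0) ->
  exists h : {linear C -> B}, forall x, h (q x) = f x.
Proof.
move=> surjq fq.
have qf x x' : q x = q x' -> f x = f x'.
  move=> /eqP; rewrite -subr_eq0 -linearB => /eqP/fq/eqP.
  by rewrite linearB subr_eq0 => /eqP.
have [|||h Dh] :=
    @linear_choice C B (fun y z => exists2 x, q x = y & f x = z).
- by move=> y; have [x Dx] := surjq y; exists (f x), x.
- by move=> _ [x qx <-]; rewrite fq.
- move=> c _ _ _ _ [x <- <-] [x' <- <-].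
  by exists (c *: x + x'); rewrite linearP.
by exists h => x; have [x' /qf Dx' <-] := Dh (q x).
Qed.

Definition projective (P : lmodType R) : Prop :=
  forall A B (p : {linear A -> B}), surjective_map p ->
  forall f : {linear P -> B}, exists h : {linear P -> A}, forall x, p (h x) = f x.

Lemma kernelE A B (f : {linear A -> B}) (z : kernel f) : f (kernel_incl f z) = 0.
Proof. by have := valP z; rewrite inE => /eqP. Qed.

Lemma kernel_incl_inj A B (f : {linear A -> B}) : injective (kernel_incl f).
Proof. exact: val_inj. Qed.

Lemma kernelP A B (f : {linear A -> B}) x :
  f x = 0 -> exists z, kernel_incl f z = x.
Proof.
move=> /eqP fx0; have fx : x \in kernel_pred f by rewrite inE.
by exists (Kernel fx).
Qed.

Lemma to_kernel A B C (f : {linear A -> B}) (h : {linear C -> A}) :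
  (forall x, f (h x) = 0) ->
  exists h' : {linear C -> kernel f}, forall x, kernel_incl f (h' x) = h x.
Proof.
move=> fh; apply: factor_inj; first exact: kernel_incl_inj.
by move=> x; apply: kernelP.
Qed.

Lemma injective0 A B (f : {linear A -> B}) :
  (forall x, f x = 0 -> x = 0) -> injective f.
Proof.
move=> f0 x y /eqP; rewrite -subr_eq0 -linearB => /eqP/f0/eqP.
by rewrite subr_eq0 => /eqP.
Qed.

Lemma inj_eq0 A B (f : {linear A -> B}) x : injective f -> f x = 0 -> x = 0.
Proof. by move=> injf fx; apply: injf; rewrite fx linear0. Qed.

End Linear.

(** * Cokernels *)

Section Cokernel.
Context {R : nzRingType} {A B : lmodType R} (f : {linear A -> B}).

Definition image_pred : {pred B} := [pred y | `[<exists x, f x = y>]].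

Fact image_zmod : zmod_closed image_pred.
Proof.
split=> [|y y']; rewrite !inE.
  by apply/asboolP; exists 0; rewrite linear0.
move=> /asboolP [x <-] /asboolP [x' <-]; apply/asboolP.
by exists (x - x'); rewrite linearB.
Qed.

HB.instance Definition _ := GRing.isZmodClosed.Build B image_pred image_zmod.

Definition coker := Quotient.quot image_pred.

HB.instance Definition _ := GRing.Zmodule.on coker.

Definition coker_class (y : B) : coker := \pi y.

Lemma coker_classE y y' :
  coker_class y = coker_class y' <-> exists x, f x = y - y'.
Proof.
rewrite /coker_class; split=> [/eqP|ff].
  by rewrite -Quotient.idealrBE inE => /asboolP.
by apply/eqP; rewrite -Quotient.idealrBE inE; apply/asboolP.
Qed.

Lemma coker_classD y y' : coker_class (y + y') = coker_class y + coker_class y'.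
Proof. by rewrite /coker_class !piE. Qed.

Lemma coker_classK (z : coker) : coker_class (repr z) = z.
Proof. exact: reprK. Qed.

Definition coker_scale (a : R) (z : coker) : coker := coker_class (a *: repr z).

Lemma coker_scaleE a y : coker_scale a (coker_class y) = coker_class (a *: y).
Proof.
have [x Dx] : exists x, f x = repr (coker_class y) - y.
  by apply/coker_classE; rewrite coker_classK.
by apply/coker_classE; exists (a *: x); rewrite linearZ_LR Dx scalerBr.
Qed.

Fact coker_scaleA a b z :
  coker_scale a (coker_scale b z) = coker_scale (a * b) z.
Proof. by rewrite -[z]coker_classK !coker_scaleE scalerA. Qed.

Fact coker_scale1 : left_id 1 coker_scale.
Proof. by move=> z; rewrite -[z]coker_classK coker_scaleE scale1r. Qed.

Fact coker_scaleDr : right_distributive coker_scale +%R.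
Proof.
move=> a z z'; rewrite -[z]coker_classK -[z']coker_classK.
by rewrite -coker_classD !coker_scaleE scalerDr coker_classD.
Qed.

Fact coker_scaleDl z : {morph coker_scale^~ z : a b / a + b}.
Proof.
move=> a b; rewrite /= -[z]coker_classK !coker_scaleE.
by rewrite scalerDl coker_classD.
Qed.

HB.instance Definition _ := GRing.Zmodule_isLmodule.Build R coker
  coker_scaleA coker_scale1 coker_scaleDr coker_scaleDl.

(** The cokernel enters later arguments through these two properties only. *)
Lemma coker_exists : exists (C : lmodType R) (q : {linear B -> C}),
  surjective_map q /\ forall y, q y = 0 <-> exists x, f x = y.
Proof.
have [|q qE] := @exists_linear R B coker coker_class.
  by move=> a y y'; rewrite coker_classD -coker_scaleE.
exists coker, q; split=> [z|y]; first by exists (repr z); rewrite qE coker_classK.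
have q0 : coker_class 0 = 0 by rewrite /coker_class !piE.
by rewrite qE -q0 coker_classE subr0.
Qed.

End Cokernel.

(** * Free modules *)

Section Free.
Context {R : nzRingType}.

Section FreeOn.
Context {K : choiceType} {B : lmodType R} (h : K -> B).

Fact malg_sum_wide (g : {malg R[K]}) (d : {fset K}) : fsubset (msupp g) d ->
  \sum_(a <- msupp g) g@_a *: h a = \sum_(a <- d) g@_a *: h a.
Proof.
move=> sgd; rewrite (big_fset_incl _ sgd) //= => a _ ag.
by rewrite mcoeff_outdom // scale0r.
Qed.

Lemma malg_extend :
  exists f : {linear {malg R[K]} -> B}, forall a, f << a >> = h a.
Proof.
have [|f fE] := @exists_linear R {malg R[K]} B
    (fun g => \sum_(a <- msupp g) g@_a *: h a).
  move=> c g g'.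
  pose d := fsetU (msupp (c *: g + g')) (fsetU (msupp g) (msupp g')).
  rewrite !(@malg_sum_wide _ d).
  - rewrite scaler_sumr -big_split; apply: eq_bigr => a _ /=.
    by rewrite mcoeffD fgscaleE scalerDl scalerA.
  - by rewrite /d fsetUA; exact: fsubsetUr.
  - by rewrite /d fsetUCA; exact: fsubsetUl.
  - exact: fsubsetUl.
exists f => a; rewrite fE (@malg_sum_wide _ [fset a]%fset) ?msuppU_le //.
by rewrite big_seq_fset1 mcoeffUU scale1r.
Qed.

Lemma malgE (g : {malg R[K]}) : g = \sum_(a <- msupp g) g@_a *: << a >>.
Proof.
rewrite {1}[g]monalgE; apply: eq_bigr => a _; apply/malgP => b.
by rewrite fgscaleE !mcoeffU mulrnAr mulr1.
Qed.

Lemma malg_ext (f f' : {linear {malg R[K]} -> B}) :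
  (forall a, f << a >> = f' << a >>) -> f =1 f'.
Proof.
move=> ff g; rewrite [g]malgE !linear_sum; apply: eq_bigr => a _.
by rewrite !linearZ_LR ff.
Qed.

End FreeOn.

Lemma malg_projective (K : choiceType) : projective {malg R[K]}.
Proof.
move=> A B p surjp f; have [h Dh] := choice (fun a : K => surjp (f << a >>)).
have [h' Dh'] := malg_extend h; exists h' => g.
have := @malg_ext K B (hom_comp p h') f; apply => a.
by rewrite /= Dh' Dh.
Qed.

End Free.

(** * Finitely generated modules *)

Section FinGen.
Context {R : nzRingType}.
Implicit Types A B C : lmodType R.

Fixpoint spanned (A : lmodType R) (s : seq A) (x : A) : Prop :=
  if s is b :: s' then exists c, spanned s' (x - c *: b) else x = 0.

Lemma spanned_submodule A (s : seq A) : submodule (spanned s).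
Proof.
elim: s => [|b s [IH0 IH]] /=.
  by split=> // c x y -> ->; rewrite scaler0 addr0.
split=> [|a x y [c sx] [d sy]]; first by exists 0; rewrite scale0r subr0.
exists (a * c + d); have := IH a _ _ sx sy.
by rewrite scalerBr addrACA -opprD scalerA -scalerDl.
Qed.

Lemma spannedP A (s : seq A) x :
  spanned s x <-> exists c : 'I_(size s) -> R, x = \sum_(i < size s) c i *: s`_i.
Proof.
elim: s x => [|b s IH] x /=.
  split=> [->|[c ->]]; last by rewrite big_ord0.
  by exists (fun=> 0); rewrite big_ord0.
split=> [[c /IH [d Dx]]|[c Dx]].
  exists (fun i => if unlift ord0 i is Some j then d j else c).
  rewrite big_ord_recl unlift_none /= -(subrK (c *: b) x) Dx addrC.
  by congr (_ + _); apply: eq_bigr => i _; rewrite liftK.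
exists (c ord0); apply/IH; exists (fun i => c (lift ord0 i)).
by rewrite Dx big_ord_recl /= addrC addKr.
Qed.

Lemma fg_spanned (A : lmodType R) :
  finitely_generated A <-> exists s : seq A, forall x, spanned s x.
Proof. by split=> [] [s sA]; exists s => x; apply/spannedP. Qed.

Lemma spanned_sub A (s : seq A) (S : A -> Prop) : submodule S ->
  (forall b, b \in s -> S b) -> forall x, spanned s x -> S x.
Proof.
move=> subS; elim: s => [|b s IH] sS x /=; first by move=> ->; apply: submodule0.
move=> [c /(IH (fun b' sb' => sS b' (mem_behead (s := b :: s) sb'))) Sx].
rewrite -(subrK (c *: b) x); apply: submoduleD => //.
by apply: submoduleZ => //; apply: sS; rewrite mem_head.
Qed.

Lemma spanned_mem A (s : seq A) b : b \in s -> spanned s b.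
Proof.
elim: s => //= b' s IH; rewrite inE => /predU1P [->|/IH sb].
  by exists 1; rewrite scale1r subrr; apply: submodule0 (spanned_submodule _).
by exists 0; rewrite scale0r subr0.
Qed.

Lemma spanned_map A B (f : {linear A -> B}) s x :
  spanned s x -> spanned (map f s) (f x).
Proof.
elim: s x => [|b s IH] x /=; first by move=> ->; rewrite linear0.
by move=> [c /IH]; exists c; rewrite -linearZ_LR -linearB.
Qed.

Lemma fg_quotient (A : fgmod R) (B : lmodType R) (f : {linear A -> B}) :
  surjective_map f -> finitely_generated B.
Proof.
case: A f => A /= /fg_spanned [s sA] f surjf; apply/fg_spanned.
by exists (map f s) => y; have [x <-] := surjf y; apply: spanned_map.
Qed.

Lemma pair_linear A B C (f : {linear C -> A}) (g : {linear C -> B}) :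
  exists h : {linear C -> (A * B)%type}, forall x, h x = (f x, g x).
Proof. by apply: exists_linear => c x y; rewrite !linearP. Qed.

Lemma fg_pair (A B : fgmod R) : finitely_generated (A * B)%type.
Proof.
case: A B => A /= /fg_spanned [s sA] [B /= /fg_spanned [t tB]].
apply/fg_spanned.
have [i iE] := pair_linear (idfun : {linear A -> A}) (0 : {linear A -> B}).
have [j jE] := pair_linear (0 : {linear B -> A}) (idfun : {linear B -> B}).
exists (map i s ++ map j t) => -[x y].
have -> : (x, y) = i x + j y :> (A * B)%type.
  by rewrite iE jE; congr pair; rewrite /= ?addr0 ?add0r.
have sub := spanned_submodule (map i s ++ map j t).
apply: submoduleD => //.
  apply: (spanned_sub sub) (spanned_map i (sA x)) => b sb.
  by apply: spanned_mem; rewrite mem_cat sb.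
apply: (spanned_sub sub) (spanned_map j (tB y)) => b sb.
by apply: spanned_mem; rewrite mem_cat sb orbT.
Qed.

Lemma fg_malg n : finitely_generated {malg R['I_n]}.
Proof.
apply/fg_spanned; exists [seq << i >> | i : 'I_n] => g.
have sub := spanned_submodule [seq << i >> | i : 'I_n].
rewrite [g]malgE; elim/big_rec: _ => [|i x _ sx].
  exact: submodule0 sub.
apply: submoduleD => //; apply: submoduleZ => //; apply: spanned_mem.
by apply/mapP; exists i; rewrite ?mem_enum.
Qed.

(** [P] is free on a finite list of generators; no minimality of [p] is claimed. *)
Lemma projective_cover (A : fgmod R) : exists (P : fgmod R)
  (p : {linear P -> A}), projective P /\ surjective_map p.
Proof.
case: A => A [s sA]; exists (FGMod (fg_malg (size s))).
have [p Dp] := @malg_extend R 'I_(size s) A (fun i => s`_i).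
exists p; split=> [|x]; first exact: malg_projective.
have [c ->] := sA x; exists (\sum_(i < size s) c i *: << i >>).
by rewrite linear_sum; apply: eq_bigr => i _; rewrite linearZ_LR Dp.
Qed.

(** * Modules of finite length *)

Lemma len_le_inj A B (f : {linear A -> B}) N :
  injective f -> len_le B N -> len_le A N.
Proof.
move=> injf lenB U subU ascU r.
pose V i y := exists2 x, U i x & f x = y.
apply: leq_trans (lenB V _ _ r).
- apply: jumps_le => i [x Ux nUx]; exists (f x); first by exists x.
  by move=> [x' Ux' /injf Dx']; apply: nUx; rewrite -Dx'.
- move=> i; split; first by exists 0; [apply: submodule0|rewrite linear0].
  move=> c _ _ [x Ux <-] [y Uy <-]; exists (c *: x + y); last by rewrite linearP.
  by case: (subU i) => _; apply.
- by move=> i _ [x Ux <-]; exists x => //; apply: ascU.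
Qed.

(** The image in [B] of a chain of [A], continued after [r] steps by [B] itself, has one more strict
    step. *)
Lemma len_le_proper A B (f : {linear A -> B}) N : injective f ->
  (exists y, forall x, f x <> y) -> len_le B N -> (0 < N)%N /\ len_le A N.-1.
Proof.
move=> injf [y fy] lenB.
have short U : (forall i, submodule (U i)) -> ascending U ->
    forall r, ((@jumps A U r).+1 <= N)%N.
  move=> subU ascU r.
  pose V i z := if (i <= r)%N then exists2 x, U i x & f x = z else True.
  apply: leq_trans (lenB V _ _ r.+1).
  - rewrite /jumps big_ord_recr /= -addn1; apply: leq_add.
      apply: leq_sum => i _; case: asboolP => // -[x Ux nUx].
      case: asboolP => // -[]; exists (f x).
        by rewrite /V ltn_ord; exists x.
      rewrite /V (ltnW (ltn_ord i)) => -[x' Ux' /injf Dx']; apply: nUx; by rewrite -Dx'.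
    case: asboolP => // -[]; exists y; first by rewrite /V ltnn.
    by rewrite /V leqnn => -[x _ /fy].
  - move=> i; rewrite /V; case: (leqP i r) => // _.
    split; first by exists 0; [apply: submodule0|rewrite linear0].
    move=> c _ _ [x Ux <-] [x' Ux' <-]; exists (c *: x + x'); last by rewrite linearP.
    by case: (subU i) => _; apply.
  - move=> i z; rewrite /V; case: (leqP i.+1 r) => // ir.
    by rewrite (ltnW ir) => -[x Ux <-]; exists x => //; apply: ascU.
have N0 : (0 < N)%N.
  apply: leq_trans (short (fun _ x => x = 0) _ _ 0%N) => //.
  by move=> _; split=> // c x x' -> ->; rewrite scaler0 addr0.
by split=> // U subU ascU r; rewrite -ltnS prednK //; apply: short.
Qed.

(** If no finite list sufficed, adjoining again and again an element of [S] outside the current span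
    would give a chain all of whose steps are strict. *)
Lemma len_le_fg A N (S : A -> Prop) : len_le A N -> submodule S ->
  exists s : seq A, (forall b, b \in s -> S b) /\ forall x, S x -> spanned s x.
Proof.
move=> lenA subS; apply: contrapT => nS.
have next (s : {s : seq A | forall b, b \in s -> S b}) :
    exists b, S b /\ ~ spanned (sval s) b.
  case: s => s sS /=; apply: contrapT => nb; apply: nS; exists s; split=> // x Sx.
  by apply: contrapT => nx; apply: nb; exists x.
have [b bP] := choice next.
have bS s : forall a, a \in b s :: sval s -> S a.
  by move=> a; rewrite inE => /predU1P [->|]; [case: (bP s)|apply: (svalP s)].
have nilS : forall a, a \in ([::] : seq A) -> S a by [].
pose s i := iter i (fun s => exist _ (b s :: sval s) (bS s)) (exist _ [::] nilS).
have [|i] := @jumps_stationary A (fun i => spanned (sval (s i))) N.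
  apply: lenA => i; first exact: spanned_submodule.
  by move=> x sx; exists 0; rewrite scale0r subr0.
case; exists (b (s i)); last by case: (bP (s i)).
by apply: spanned_mem; rewrite mem_head.
Qed.

Section FiniteLength.
Context (finite_len : forall A : fgmod R, exists N, len_le A N).

Lemma fg_kernel (A : fgmod R) B (f : {linear A -> B}) :
  finitely_generated (kernel f).
Proof.
have [N lenA] := finite_len A.
have subK : submodule (fun x => f x = 0).
  by split=> [|c x y fx fy]; rewrite ?linear0 // linearP fx fy scaler0 addr0.
have [s [sK Ks]] := len_le_fg lenA subK.
have [t Dt] : exists t, map (kernel_incl f) t = s.
  elim: s sK {Ks} => [|b s IH] sK; first by exists [::].
  have [|t Dt] := IH; first by move=> b' sb'; apply: sK; rewrite inE sb' orbT.
  have [z Dz] := kernelP (sK b (mem_head _ _)).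
  by exists (z :: t); rewrite -Dz -Dt.
apply/fg_spanned; exists t => z; have := Ks _ (kernelE z); rewrite -Dt.
elim: t z {Dt} => [|b t IH] z /=; first by move=> z0; apply: kernel_incl_inj.
move=> [c sz]; exists c; apply: IH.
by rewrite linearB [kernel_incl f (c *: b)]linearZ_LR.
Qed.

Definition ker_fg (A : fgmod R) B (f : {linear A -> B}) : fgmod R :=
  FGMod (fg_kernel f).

Lemma iter_linear (A : lmodType R) (phi : {linear A -> A}) n :
  exists psi : {linear A -> A}, forall x, psi x = iter n phi x.
Proof.
apply: exists_linear; elim: n => // n IH c x y /=.
by rewrite IH linearP.
Qed.

(** [S] is the geometric sum of the powers of [phi] with exponent below [n]. *)
Lemma iter_sum_linear (A : lmodType R) (phi : {linear A -> A}) n :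
  exists S : {linear A -> A}, forall x, S (x - phi x) = x - iter n phi x.
Proof.
elim: n => [|n [S IH]]; first by exists 0 => x; rewrite subrr.
have [psi psiE] := iter_linear phi n.
exists (S + psi) => x; rewrite homDE IH linearB !psiE.
by rewrite -iterSr addrA subrK.
Qed.

Lemma iter_kernel_stationary (A : fgmod R) (phi : {linear A -> A}) :
  exists i, forall j x, (i <= j)%N -> iter j phi x = 0 -> iter i phi x = 0.
Proof.
have [N lenA] := finite_len A.
have [|i nj] := @jumps_stationary A (fun i x => iter i phi x = 0) N.
  apply: lenA => i; last by move=> x /= ->; rewrite linear0.
  have [psi psiE] := iter_linear phi i.
  split=> [|c x y]; rewrite -!psiE ?linear0 // => px py.
  by rewrite linearP px py scaler0 addr0.
have step x : iter i.+1 phi x = 0 -> iter i phi x = 0 by apply: nojump nj.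
exists i => j x /subnKC <-; elim: (j - i)%N => [|d IH]; first by rewrite addn0.
by rewrite iterD iterS -iterSr => /step; rewrite -iterD.
Qed.

Lemma iter_image_stationary (A : fgmod R) (phi : {linear A -> A}) :
  exists i, forall j x, (i <= j)%N -> exists y, iter i phi x = iter j phi y.
Proof.
have [N lenA] := finite_len A.
(* The images of the powers of [phi] descend while [jumps] counts ascending steps, so they are
   listed backwards. One of the first [N.+1] steps cannot be strict. *)
pose V i x := exists y, x = iter (N.+1 - i) phi y.
have [i iN nj] : exists2 i, (i < N.+1)%N & ~ jump V i.
  apply: contrapT => nj; suff: (jumps V N.+1 <= N)%N.
    rewrite jumps_eq ?ltnn // => i iN; apply: contrapT => ni.
    by apply: nj; exists i.
  apply: lenA => i; last first.
    move=> x [y ->]; case: (leqP i N) => [iN|Ni].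
      by exists (phi y); rewrite -iterSr subSn.
    exists y; rewrite (eqP (Ni : N.+1 - i == 0)%N).
    by rewrite (eqP (leqW Ni : N.+1 - i.+1 == 0)%N).
  have [psi psiE] := iter_linear phi (N.+1 - i).
  split=> [|c x y [x' ->] [y' ->]]; first by exists 0; rewrite -psiE linear0.
  by exists (c *: x' + y'); rewrite -!psiE linearP.
have step y : exists z, iter (N - i) phi y = iter (N - i).+1 phi z.
  have [|z Dz] := nojump nj (y := iter (N - i) phi y).
    by exists y; rewrite subSS.
  by exists z; rewrite Dz subSn.
exists (N - i)%N => j x /subnKC <-.
elim: (j - _)%N => [|d [y ->]]; first by exists x; rewrite addn0.
have [z Dz] := step y; exists z.
by rewrite (addnC _ d) iterD Dz -iterD !addnS (addnC d).
Qed.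

Lemma inj_surj_iso (A B : lmodType R) (f : {linear A -> B}) :
  injective f -> surjective_map f -> is_iso f.
Proof.
move=> injf surjf; have [h Dh] := factor_inj (f := idfun) injf surjf.
by exists h; split=> x; [apply: injf; rewrite Dh|apply: Dh].
Qed.

(* Fitting's lemma for [phi = 1 - g u]: on the kernel of a large power of [phi],
   [g u] is invertible with inverse [\sum_(i < n) phi^i], so the projection onto
   this kernel along the image of [phi^n] factors through [u]. *)
Lemma fitting_idempotent (A B : fgmod R) (u : {linear A -> B})
    (g : {linear B -> A}) : ~ is_iso (idfun \- (g \o u)) ->
  exists r : {linear B -> A}, (forall y, r (u (r y)) = r y) /\
    exists x, r (u x) <> 0.
Proof.
set phi : {linear A -> A} := idfun \- (g \o u) => niso.
have phiE x : g (u x) = x - phi x by rewrite /phi /= subKr.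
have [i ki] := iter_kernel_stationary phi.
have [j kj] := iter_image_stationary phi.
(* The successor makes [n] positive, so that bijectivity of [phi] can be read off from its [n]-th
   power [psi]. *)
pose n := (i + j).+1; have [psi psiE] := iter_linear phi n.
have iterK l m x : iter l phi x = 0 -> (l <= m)%N -> iter m phi x = 0.
  move=> l0 /subnK <-; rewrite iterD l0.
  by have [chi chiE] := iter_linear phi (m - l); rewrite -chiE linear0.
have ker2 x : psi (psi x) = 0 -> psi x = 0.
  rewrite !psiE -iterD => /ki i0; apply: iterK (i0 _) _; rewrite /n; last first.
    exact/leqW/leq_addr.
  by rewrite addSn; apply/leqW; rewrite -addnA leq_addr.
have im2 x : exists w, psi (psi w) = psi x.
  have [|w Dw] := kj (j + n)%N x; first exact: leq_addr.
  have jn : (j <= n)%N by rewrite /n leqW // leq_addl.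
  by exists w; rewrite !psiE -{3}(subnK jn) iterD Dw -!iterD addnA subnK.
have [|||e De] := @linear_choice R A A
    (fun x y => exists2 w, psi (psi w) = psi x & y = x - psi w).
- by move=> x; have [w Dw] := im2 x; exists (x - psi w), w.
- by move=> y [w]; rewrite linear0 => /ker2 -> ->; rewrite subr0.
- move=> c x x' _ _ [w Dw ->] [w' Dw' ->]; exists (c *: w + w').
    by rewrite !linearP Dw Dw'.
  by rewrite linearP scalerBr addrACA -opprD.
have psie x : psi (e x) = 0.
  by have [w Dw ->] := De x; rewrite linearB Dw subrr.
have eK x : psi x = 0 -> e x = x.
  by have [w Dw ->] := De x => x0; rewrite (ker2 w) ?subr0 // Dw.
have epsi x : e (psi x) = 0.
  have [w Dw ->] := De (psi x).
  by rewrite -linearB; apply: ker2; rewrite !linearB Dw subrr.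
have [S SE] := iter_sum_linear phi n.
have eE x : e (S (g (u x))) = e x.
  by rewrite phiE SE -psiE linearB epsi subr0.
(* For [r = e S g] one has [r u = e], which is the identity on the image of [r]. Were [e] zero,
   [phi] would be bijective. *)
exists (hom_comp e (hom_comp S g)); split=> [y|] /=.
  by rewrite eE eK.
apply: contrapT => e0; apply: niso.
have {}e0 x : e x = 0.
  by apply: contrapT => ex; apply: e0; exists x; rewrite eE.
apply: inj_surj_iso.
  apply: injective0 => x phix; rewrite -(eK x) ?e0 // psiE.
  by apply: (iterK 1%N).
move=> x; have [w Dw Dx] := De x; exists (iter (i + j) phi w).
by apply/eqP; rewrite eq_sym -subr_eq0 -[_ (iter _ _ _)]/(iter n phi w) -psiE -Dx e0.
Qed.

End FiniteLength.
End FinGen.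

(** * Vanishing and effaceability of Ext *)

Section ExtVanishing.
Context {R : nzRingType}.
Implicit Types A B C : lmodType R.

Definition is_cocycle i A B (phi : {linear res A i -> B}) : Prop :=
  forall x, phi (res_diff A i x) = 0.

Definition coboundary i A B (phi : {linear res A i.+1 -> B}) : Prop :=
  exists h : {linear res A i -> B}, forall x, phi x = h (res_diff A i x).

Lemma coboundaryE i A B (phi : {linear res A i.+1 -> B}) :
  coboundary phi <-> is_coboundary phi.
Proof.
split=> [[h Dh]|[h ->]]; last by exists h.
by exists h; apply: linear_ext.
Qed.

Lemma cocycleP i A B (phi : {linear res A i -> B}) :
  is_cocycle phi -> exists c : cocycle i A B, cocycle_val c = phi.
Proof.
move=> coc; have cphi : phi \in @cocycle_pred R i A B.
  by rewrite inE; apply/eqP/linear_ext.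
by exists (Cocycle cphi).
Qed.

Lemma cocycle_is_cocycle i A B (c : cocycle i A B) : is_cocycle (cocycle_val c).
Proof.
move=> x; have := valP c; rewrite inE => /eqP c0.
by have := congr1 (fun h : {linear _ -> _} => h x) c0.
Qed.

Lemma Ext_class_eq0 i A B (c : cocycle i.+1 A B) :
  Ext_class c = 0 <-> coboundary (cocycle_val c).
Proof.
rewrite coboundaryE -[0](Ext_class0 i.+1 A B) Ext_class_eq.
by have -> : cocycle_val c - cocycle_val 0 = cocycle_val c; first exact: subr0.
Qed.

Lemma Ext_eq0 i A B : (forall e : Ext i.+1 A B, e = 0) <->
  forall phi : {linear res A i.+1 -> B}, is_cocycle phi -> coboundary phi.
Proof.
split=> [E0 phi /cocycleP [c <-]|cob e]; first exact/Ext_class_eq0.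
have [c ->] := Ext_classP e; apply/Ext_class_eq0/cob.
exact: cocycle_is_cocycle.
Qed.

Lemma res_diff_diff A i (x : res A i.+2) : res_diff A i (res_diff A i.+1 x) = 0.
Proof. by apply/res_exact; exists x. Qed.

Lemma hom_compE A B C (u : {linear B -> C}) (f : {linear A -> B}) x :
  hom_comp u f x = u (f x).
Proof. by []. Qed.

Lemma res_projective A i : projective (res A i).
Proof. exact: malg_projective. Qed.

Lemma cocycle_comp i A B C (u : {linear B -> C}) (phi : {linear res A i -> B}) :
  is_cocycle phi -> is_cocycle (hom_comp u phi).
Proof. by move=> coc x; rewrite /= coc linear0. Qed.

Lemma coboundary_post i A B C (u : {linear B -> C})
    (phi : {linear res A i.+1 -> B}) :
  coboundary phi -> coboundary (hom_comp u phi).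
Proof. by move=> [h Dh]; exists (hom_comp u h) => x; rewrite /= Dh. Qed.

Lemma counit_surjective A : surjective_map (counit (A := A)).
Proof. exact: counit_surj. Qed.

Lemma res_diff_surj A i (z : syzygy (iter i syzygy A)) :
  exists y, res_diff A i y = kernel_incl _ z.
Proof. by have [y <-] := counit_surj z; exists y. Qed.

Lemma cocycle0P A B (phi : {linear res A 0 -> B}) : is_cocycle phi ->
  exists f : {linear A -> B}, forall x, f (counit x) = phi x.
Proof.
move=> coc; apply: factor_surj; first exact: counit_surjective.
move=> x /kernelP [z <-]; have [y <-] := @res_diff_surj A 0 z.
exact: coc.
Qed.

(** The kernel of [counit] is the image of the next differential, on which cocycles vanish; so
    cocycles of positive degree are maps out of a syzygy. *)
Lemma cocycle_syzygy A i B (phi : {linear res A i.+1 -> B}) : is_cocycle phi ->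
  exists f : {linear syzygy (iter i syzygy A) -> B},
    forall x, f (counit x) = phi x.
Proof.
move=> coc; apply: factor_surj; first exact: counit_surjective.
move=> x /kernelP [z <-]; have [y <-] := @res_diff_surj A i.+1 z.
exact: coc.
Qed.

End ExtVanishing.

Section Effaceable.
Context {R : nzRingType}.
Context (finite_len : forall A : fgmod R, exists N, len_le A N).

(** [Z] is a direct summand of [Y] plus a projective module. Syzygies in the standard resolution
    need not be finitely generated; this relation compares them with finitely generated modules. *)
Definition stable_retract (Z : lmodType R) (Y : fgmod R) : Prop :=
  exists (a : {linear Z -> Y}) (b : {linear Y -> Z}) (Q : lmodType R)
    (w : {linear Z -> Q}) (v : {linear Q -> Z}),
  projective Q /\ forall x, x = b (a x) + v (w x).

(** Lifting [a] and [b] to the projectives [P] and [{malg R[Z]}] and restricting to kernels gives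
    the maps between [N] and the syzygy. The error [rho] is defined on the whole free module, hence
    factors through a projective. *)
Lemma stable_retract_syzygy (Z : lmodType R) (Y : fgmod R) :
  stable_retract Z Y ->
  exists (P N : fgmod R) (inc : {linear N -> P}) (a0 : {linear {malg R[Z]} -> P})
    (a : {linear syzygy Z -> N}) (b : {linear N -> syzygy Z})
    (rho : {linear {malg R[Z]} -> syzygy Z}),
  [/\ injective inc, forall s, inc (a s) = a0 (kernel_incl _ s) &
      forall s, s = b (a s) + rho (kernel_incl _ s)].
Proof.
move=> [a [b [Q [w [v [projQ Dx]]]]]].
have [P [p [projP surjp]]] := projective_cover Y.
have [a0 Da0] := malg_projective surjp (hom_comp a (counit (A := Z))).
have [b0 Db0] := projP _ _ _ (@counit_surjective R Z) (hom_comp b p).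
have [v' Dv'] := projQ _ _ _ (@counit_surjective R Z) v.
pose N := ker_fg finite_len p; pose inc : {linear N -> P} := kernel_incl p.
have [a' Da'] : exists a' : {linear syzygy Z -> N},
    forall s, inc (a' s) = a0 (kernel_incl _ s).
  have [|h Dh] := to_kernel (f := p) (h := hom_comp a0 (kernel_incl (counit (A := Z)))).
    by move=> s; have /= -> := Da0 (kernel_incl _ s); rewrite kernelE linear0.
  by exists h.
have [b' Db'] : exists b' : {linear N -> syzygy Z},
    forall y, kernel_incl _ (b' y) = b0 (inc y).
  have [|h Dh] := to_kernel (f := counit (A := Z)) (h := hom_comp b0 inc).
    by move=> y; have /= -> := Db0 (inc y); rewrite kernelE linear0.
  by exists h.
(* The last term brings the difference into the kernel of [counit] and vanishes on the syzygy, where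
   [rho] is therefore the identity minus [b' a']. *)
have [|rho Drho] := to_kernel (f := counit (A := Z))
    (h := (idfun : {linear {malg R[Z]} -> {malg R[Z]}}) - hom_comp b0 a0
          - hom_comp v' (hom_comp w (counit (A := Z)))).
  move=> r; rewrite !homBE !linearB /=.
  have /= -> := Db0 (a0 r); have /= -> := Da0 r; have /= -> := Dv' (w (counit r)).
  by rewrite {1}[counit r]Dx addrAC addrK subrr.
exists P, N, inc, a0, a', b', rho; split=> // [|s]; first exact: kernel_incl_inj.
apply: (@kernel_incl_inj R _ _ (counit (A := Z))).
rewrite linearD Db' Da' Drho !homBE /= kernelE !linear0 addr0.
by rewrite addrC subrK.
Qed.

Lemma syzygy_stable_retract (Y : fgmod R) i :
  exists Y' : fgmod R, stable_retract (iter i syzygy Y) Y'.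
Proof.
elim: i => [|i [Y' /stable_retract_syzygy]].
  exists Y, idfun, idfun, {malg R['I_0]}, 0, 0; split=> [|x].
    exact: malg_projective.
  by rewrite addr0.
move=> [P [N [inc [a0 [a [b [rho [_ _ Ds]]]]]]]]; exists N.
exists a, b, {malg R[iter i syzygy Y]}, (kernel_incl _), rho; split=> //.
exact: malg_projective.
Qed.

(** [E] is the pushout of [inc : N -> P] along [phi' b : N -> B], where [phi'] is [phi] seen on the
    syzygy. Using [N] and [P] instead of the standard resolution keeps [E] finitely generated. *)
Lemma Ext_effaceable (Y B : fgmod R) i (phi : {linear res Y i.+1 -> B}) :
  is_cocycle phi ->
  exists (E : fgmod R) (j : {linear B -> E}),
  [/\ injective j, coboundary (hom_comp j phi) &
      forall (D : lmodType R) (f : {linear B -> D}), (forall x, f (phi x) = 0) ->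
        exists f' : {linear E -> D}, forall x, f' (j x) = f x].
Proof.
move=> /cocycle_syzygy [phi' Dphi].
have [Y' /stable_retract_syzygy] := syzygy_stable_retract Y i.
move=> [P [N [inc [a0 [a [b [rho [inj_inc Dinc Ds]]]]]]]].
have [k Dk] := pair_linear (hom_comp phi' b) (- inc).
have [E [q [surjq q0]]] := coker_exists k.
have [iB DiB] := pair_linear (idfun : {linear B -> B}) (0 : {linear B -> P}).
pose BP := FGMod (fg_pair B P).
exists (FGMod (fg_quotient (A := BP) surjq)), (hom_comp q iB); split.
- apply: injective0 => x /= /q0 [y]; rewrite Dk DiB => -[/= <- /eqP].
  by rewrite oppr_eq0 => /eqP/(inj_eq0 inj_inc) ->; rewrite !linear0.
(* By the decomposition [Ds], the pairs [(phi x, 0)] and [(phi' (rho s), a0 s)] differ by [k (a s)],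
   hence agree in [E]; the second one is defined on the whole free module. *)
- have [h Dh] := pair_linear (hom_comp phi' rho) a0.
  exists (hom_comp q h) => x /=.
  set s := counit x; rewrite -Dphi -/s.
  apply/eqP; rewrite -subr_eq0 -linearB; apply/eqP/q0; exists (a s).
  have /= Es := congr1 phi' (Ds s); have /= Ea := Dinc s.
  rewrite Dk Dh DiB /=; congr pair; last by rewrite /= sub0r -Ea.
  by rewrite /= Es linearD addrK.
- move=> D f fphi.
  have [f1 Df1] : exists f1 : {linear (B * P)%type -> D}, forall z, f1 z = f z.1.
    by apply: exists_linear => c [x y] [x' y']; rewrite /= linearP.
  have [|f' Df'] := factor_surj (f := f1) surjq.
    move=> z /q0 [y <-]; rewrite Df1 Dk /=.
    by have [x <-] := counit_surj (b y); rewrite Dphi fphi.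
  by exists f' => x; rewrite /= Df' Df1 DiB.
Qed.

End Effaceable.

(** * Extensions in a cluster tilting subcategory *)

Section Sequences.
Context {R : nzRingType}.

Definition short_exact (A B C : lmodType R) (a : {linear A -> B})
    (b : {linear B -> C}) : Prop :=
  [/\ injective a, surjective_map b & forall y, b y = 0 <-> exists x, a x = y].

(* There is an exact sequence 0 -> C -> c_j -> ... -> c_1 -> Z -> 0 with all
   c_i in M and of total length at most N. *)
Inductive resolved (M : fgmod R -> Prop) (Z : fgmod R) :
    nat -> nat -> fgmod R -> Prop :=
| resolved0 (C : fgmod R) (i : {linear C -> Z}) : is_iso i -> resolved M Z 0 0 C
| resolvedS j N N' (C c C' : fgmod R) (a : {linear C -> c})
    (b : {linear c -> C'}) : M c -> short_exact a b -> len_le c N ->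
    resolved M Z j N' C' -> resolved M Z j.+1 (N + N') C.


Definition is_pullback (F A B C : lmodType R) (t : {linear A -> C})
    (p : {linear B -> C}) (k1 : {linear F -> A}) (k2 : {linear F -> B}) : Prop :=
  [/\ forall z, k1 z = 0 -> k2 z = 0 -> z = 0,
      forall z, t (k1 z) = p (k2 z) &
      forall y y', t y = p y' -> exists2 z, k1 z = y & k2 z = y'].

Section Pullback.
Context {F A B C : lmodType R} {t : {linear A -> C}} {p : {linear B -> C}}.
Context {k1 : {linear F -> A}} {k2 : {linear F -> B}}.
Context (pb : is_pullback t p k1 k2).

Lemma pullback_inj z z' : k1 z = k1 z' -> k2 z = k2 z' -> z = z'.
Proof.
move=> /eqP; rewrite -subr_eq0 -linearB => /eqP k1z.
move=> /eqP; rewrite -subr_eq0 -linearB => /eqP.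
case: pb => kinj _ _ /(kinj _ k1z) /eqP.
by rewrite subr_eq0 => /eqP.
Qed.

Lemma pullback_lift (D : lmodType R) (h1 : {linear D -> A})
    (h2 : {linear D -> B}) : (forall x, t (h1 x) = p (h2 x)) ->
  exists h : {linear D -> F}, forall x, k1 (h x) = h1 x /\ k2 (h x) = h2 x.
Proof.
case: pb => kinj tk kpair Dh.
apply: (@linear_choice R D F (fun x z => k1 z = h1 x /\ k2 z = h2 x)).
- by move=> x; have [z D1 D2] := kpair _ _ (Dh x); exists z.
- by move=> z; rewrite !linear0 => -[]; apply: kinj.
- by move=> a x x' z z' [D1 D2] [D1' D2']; rewrite !linearP D1 D1' D2 D2'.
Qed.

End Pullback.

End Sequences.

Section ClusterTilting.
Context {R : nzRingType}.
Context (finite_len : forall A : fgmod R, exists N, len_le A N).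
Context (n : nat) (M : fgmod R -> Prop).
Context (ctM : cluster_tilting n M).
Implicit Types a b : fgmod R.

Lemma pullback_exists (A B : fgmod R) (C : lmodType R) (t : {linear A -> C})
    (p : {linear B -> C}) :
  exists (F : fgmod R) (k1 : {linear F -> A}) (k2 : {linear F -> B}),
  is_pullback t p k1 k2.
Proof.
have [d Dd] : exists d : {linear (A * B)%type -> C},
    forall z, d z = t z.1 - p z.2.
  apply: exists_linear => c [x y] [x' y'] /=.
  by rewrite [t _]linearP [p _]linearP scalerBr opprD addrACA.
have [k1 Dk1] : exists k1 : {linear kernel d -> A},
    forall z, k1 z = (kernel_incl d z).1 by apply: exists_linear.
have [k2 Dk2] : exists k2 : {linear kernel d -> B},
    forall z, k2 z = (kernel_incl d z).2 by apply: exists_linear.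
exists (ker_fg finite_len (A := FGMod (fg_pair A B)) d), k1, k2; split=> [z|z|y y' tp].
- rewrite Dk1 Dk2 => z1 z2; apply: (@kernel_incl_inj _ _ _ d).
  by rewrite linear0 [LHS]surjective_pairing z1 z2.
- by apply/eqP; rewrite -subr_eq0 Dk1 Dk2 -Dd kernelE.
- have [|z Dz] := kernelP (f := d) (x := (y, y')).
    by rewrite Dd tp subrr.
  by exists z; rewrite ?Dk1 ?Dk2 Dz.
Qed.

Lemma ct_Ext_vanish a b i : M a -> M b -> (0 < i < n)%N ->
  forall e : Ext i a b, e = 0.
Proof. by case: ctM => _ _ _ /(_ b) [H _] _ Ma /H; apply. Qed.

Lemma ct_Ext_char b : (forall a, M a -> forall i, (0 < i < n)%N ->
  forall e : Ext i a b, e = 0) -> M b.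
Proof. by case: ctM => _ _ _ /(_ b) [_ H] _. Qed.

(** An epimorphism from an object of [M] factors through every precover and forces it to be onto. *)
Lemma ct_surj_precover b : exists (c : fgmod R) (p : {linear c -> b}),
  is_precover M p /\ surjective_map p.
Proof.
case: ctM => _ /(_ b) [[c [p preP]] _] [/(_ b) [m Mm [q surjq]] _] _ _.
exists c, p; split=> // y; have [x <-] := surjq y.
by case: preP => _ /(_ m Mm q) [h ph]; exists (h x); apply: ph.
Qed.

Lemma ct_inj_preenvelope b : exists (c : fgmod R) (p : {linear b -> c}),
  is_preenvelope M p /\ injective p.
Proof.
case: ctM => _ /(_ b) [_ [c [p preP]]] [_ /(_ b) [m Mm [q injq]]] _ _.
exists c, p; split=> //; apply: injective0 => x px.
case: preP => _ /(_ m Mm q) [h hp]; apply: (inj_eq0 injq).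
by rewrite -(hp x) /= px linear0.
Qed.

(* Ext^i(Y, -) of the pullback of t along p, from the exact sequence
   0 -> ker p -> F -> mt -> 0. *)
Lemma Ext_pullback_vanish (Y F mt c F' : fgmod R) (t : {linear mt -> F'})
    (p : {linear c -> F'}) (k1 : {linear F -> mt}) (k2 : {linear F -> c}) i :
  surjective_map p -> is_pullback t p k1 k2 ->
  (forall g : {linear Y -> F'}, exists h : {linear Y -> c}, p \o h =1 g) ->
  (forall e : Ext i.+1 Y mt, e = 0) -> (forall e : Ext i.+1 Y c, e = 0) ->
  ((0 < i)%N -> forall e : Ext i Y F', e = 0) ->
  forall e : Ext i.+1 Y F, e = 0.
Proof.
move=> surjp pb liftY /Ext_eq0 Emt /Ext_eq0 Ec EF'; apply/Ext_eq0.
move=> psi coc.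
have [h1 Dh1] := Emt _ (cocycle_comp k1 coc).
have [h2 Dh2] := Ec _ (cocycle_comp k2 coc).
pose chi : {linear res Y i -> F'} := hom_comp t h1 - hom_comp p h2.
have chi_coc : is_cocycle chi.
  move=> x; have /= D1 := Dh1 x; have /= D2 := Dh2 x.
  by apply/eqP; rewrite /= subr_eq0 -D1 -D2; case: pb => _ ->.
(* In degree 0 the cocycle [chi] is a map from [Y] and lifts by [liftY]. In higher degree it is a
   coboundary, and its primitive lifts along [p] by projectivity. Adding [chi'] to [h2] makes the
   two primitives compatible. *)
have [chi' coc' Dchi'] : exists2 chi' : {linear res Y i -> c},
    is_cocycle chi' & forall x, p (chi' x) = chi x.
  case: i EF' {Emt Ec} psi coc h1 Dh1 h2 Dh2 @chi chi_coc => [|i] EF'.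
    move=> _ _ h1 _ h2 _ chi /cocycle0P [g Dg].
    have [g' Dg'] := liftY g; exists (hom_comp g' (counit (A := Y))) => x /=.
      by have := kernelE (counit x); rewrite /= => ->; rewrite linear0.
    exact: etrans (Dg' _) (Dg x).
  move=> _ _ h1 _ h2 _ chi /((Ext_eq0 _ _ _).1 (EF' isT)) [g Dg].
  have [g' Dg'] := @res_projective R Y i _ _ p surjp g.
  exists (hom_comp g' (res_diff Y i)) => x /=.
    by have := kernelE (counit x); rewrite /= => ->; rewrite !linear0.
  exact: etrans (Dg' _) (esym (Dg x)).
have [|h Dh] := pullback_lift pb (h1 := h1) (h2 := h2 + chi').
  by move=> x; rewrite homDE linearD Dchi' /chi homBE /= addrC subrK.
exists h => x; have [D1 D2] := Dh (res_diff Y i x).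
have /= E1 := Dh1 x; have /= E2 := Dh2 x.
by apply: (pullback_inj pb); rewrite ?D1 ?D2 ?homDE ?E1 ?E2 //= coc' addr0.
Qed.

(* Dimension shifting: phi comes from a class of degree j on the cokernel of io,
   to which the induction hypothesis applies; F is the pullback of mt and of an
   M-precover of the term obtained there. *)
Lemma extension_resolution (x' : fgmod R) j (S mt : fgmod R)
    (io : {linear S -> mt}) (phi : {linear res x' j.+1 -> S}) :
  M x' -> (j < n)%N -> injective io -> M mt -> is_cocycle phi ->
  coboundary (hom_comp io phi) ->
  exists (F C : fgmod R) (al : {linear S -> F}) (be : {linear F -> C})
    (ka : {linear F -> mt}) (N : nat),
  [/\ short_exact al be, forall z, ka (al z) = io z, resolved M x' j N C,
      coboundary (hom_comp al phi) &
      forall Y, M Y -> forall i, (0 < i <= j)%N -> forall e : Ext i Y F, e = 0].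
Proof.
move=> Mx'; elim: j S mt io phi => [|j IH] S mt io phi jn inj_io Mmt coc [h Dh].
  (* In degree 1, [h] induces [t : x' -> S'] on the cokernel of [io], and [F] is the pullback of
     [mt] along [t]. *)
  have [S' [q [surjq q0]]] := coker_exists io.
  have coc' : is_cocycle (hom_comp q h).
    by move=> x; have /= := Dh x => <-; apply/q0; exists (phi x).
  have [t Dt] := cocycle0P coc'.
  have [F [k1 [k2 pb]]] := pullback_exists q t.
  have [|al Dal] := pullback_lift pb (h1 := io) (h2 := 0).
    by move=> z; rewrite hom0E linear0; apply/q0; exists z.
  exists F, x', al, k2, k1, 0%N; split; last by move=> Y _ [].
  - split.
    + apply: injective0 => z al0; apply: (inj_eq0 inj_io).
      by rewrite -(Dal z).1 al0 linear0.
    + move=> y; have [m Dm] := surjq (t y); case: pb => _ _ /(_ _ _ Dm) [z _ <-].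
      by exists z.
    + move=> z; split=> [k2z|[w <-]]; last by rewrite (Dal w).2.
      have [|w Dw] := (q0 (k1 z)).1.
        by case: pb => _ -> _; rewrite k2z linear0.
      by exists w; apply: (pullback_inj pb); rewrite ?(Dal w).1 ?(Dal w).2 ?k2z.
  - by move=> z; rewrite (Dal z).1.
  - by apply: (@resolved0 _ _ _ x' idfun); exists idfun.
  - have [|H DH] := pullback_lift pb (h1 := h) (h2 := counit (A := x')).
      by move=> x; rewrite Dt.
    exists H => x; rewrite hom_compE; apply: (pullback_inj pb).
      by rewrite (Dal _).1 (DH _).1 -Dh.
    by rewrite (Dal _).2 (DH _).2; apply/esym: (kernelE (counit x)).
have [S' [q [surjq q0]]] := coker_exists io.
pose S'fg := FGMod (fg_quotient surjq).
have [mt' [io' [[Mmt' _] inj_io']]] := ct_inj_preenvelope S'fg.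
have coc' : is_cocycle (hom_comp q h).
  by move=> x; have /= := Dh x => <-; apply/q0; exists (phi x).
(* This is where [j.+1 < n] enters: the class shifted to the cokernel dies in [mt'] because both
   [x'] and [mt'] lie in [M]. *)
have cob' : coboundary (hom_comp io' (hom_comp q h)).
  have /Ext_eq0 := @ct_Ext_vanish x' mt' j.+1 Mx' Mmt' jn; apply.
  exact: cocycle_comp.
have [F' [C' [al' [be' [_ [N' [[inj_al' surj_be' ex'] _ resC' [h2 Dh2] van]]]]]]] :=
  IH S'fg mt' io' (hom_comp q h) (ltnW jn) inj_io' Mmt' coc' cob'.
have [c [p [[Mc prep] surjp]]] := ct_surj_precover F'.
have [F [k1 [k2 pb]]] := pullback_exists (hom_comp al' q) p.
have [kinj tk kpair] := pb.
have [|al Dal] := pullback_lift pb (h1 := io) (h2 := 0).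
  move=> z; rewrite hom0E linear0 /=.
  by have -> : q (io z) = 0 by [apply/q0; exists z]; rewrite linear0.
(* The kernel of [c -> F' -> C'] prolongs the resolution of [C'] by the term [c]. *)
pose C := ker_fg finite_len (hom_comp be' p).
have [|be Dbe] := to_kernel (f := hom_comp be' p) (h := k2).
  by move=> z; rewrite /= -tk; apply/ex'; exists (q (k1 z)).
have [N lenc] := finite_len c.
exists F, C, al, be, k1, (N + N')%N; split.
- split.
  + apply: injective0 => z al0; apply: (inj_eq0 inj_io).
    by rewrite -(Dal z).1 al0 linear0.
  + move=> y; have /= /ex' [w Dw] := kernelE y.
    have [v Dv] := surjq w.
    have [|z _ Dz] := kpair v (kernel_incl _ y); first by rewrite /= Dv Dw.
    by exists z; apply: kernel_incl_inj; rewrite Dbe.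
  + move=> z; split=> [be0|[w <-]]; last first.
      by apply: kernel_incl_inj; rewrite Dbe (Dal w).2 linear0.
    have k2z : k2 z = 0 by rewrite -Dbe be0 linear0.
    have [|w Dw] := (q0 (k1 z)).1.
      by apply: (inj_eq0 inj_al'); have /= -> := tk z; rewrite k2z linear0.
    by exists w; apply: (pullback_inj pb); rewrite ?(Dal w).1 ?(Dal w).2 ?k2z.
- by move=> z; rewrite (Dal z).1.
- apply: (@resolvedS _ M x' j N N' C c C' (kernel_incl _) (hom_comp be' p)) => //.
  split; first exact: kernel_incl_inj.
    by move=> y; have [z <-] := surj_be' y; have [w <-] := surjp z; exists w.
  by move=> y; split=> [/kernelP//|[z <-]]; apply: kernelE.
(* The primitive into the pullback has components [h] in [mt] and, lifting [h2] along [p], [h3]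
   after the differential in [c]; the latter vanishes on boundaries. *)
- have [h3 Dh3] := @res_projective R x' j _ _ p surjp h2.
  have [|H DH] := pullback_lift pb (h1 := h) (h2 := hom_comp h3 (res_diff x' j)).
    by move=> x; have /= -> := Dh2 x; have /= -> := Dh3 (res_diff x' j x).
  exists H => x; rewrite hom_compE; apply: (pullback_inj pb).
    by rewrite (Dal _).1 (DH _).1 -Dh.
  by rewrite (Dal _).2 (DH _).2 hom_compE res_diff_diff linear0.
- move=> Y MY [//|i] ij; have in_ : (0 < i.+1 < n)%N by apply: leq_ltn_trans jn.
  apply: (Ext_pullback_vanish surjp pb); first exact: prep.
  + exact: ct_Ext_vanish.
  + exact: ct_Ext_vanish.
  + by move=> i0; apply: van; rewrite // i0.
Qed.

End ClusterTilting.

(** * Almost minimal sequences *)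

Section AlmostMinimal.
Context {R : nzRingType}.

(** The index [w] is the map arriving at [C] from the left, so that the composite [F -> C -> c] can
    be required to be radical. In the base case [w] is unrestricted, as the last map of an almost
    minimal sequence is. *)
Inductive minimal_resolution (M : fgmod R -> Prop) (Z : fgmod R) :
    nat -> forall F C : fgmod R, {linear F -> C} -> Prop :=
| minimal_resolution0 (F C : fgmod R) (w : {linear F -> C})
    (i : {linear C -> Z}) : is_iso i -> minimal_resolution M Z 0 w
| minimal_resolutionS j (F C c C' : fgmod R) (w : {linear F -> C})
    (a : {linear C -> c}) (b : {linear c -> C'}) : M c -> short_exact a b ->
    radical (hom_comp a w) -> minimal_resolution M Z j b ->
    minimal_resolution M Z j.+1 w.

(** The part of the sequence to the left of [C] is collected in the chain [E], with [F] at index 0.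
    Each step of the induction adds the next term at index 0 and keeps [t + j] fixed; once [Z] is
    reached, the sequence is complete and closure under extensions applies. *)
Lemma minimal_resolution_closed (M X : fgmod R -> Prop) (Z : fgmod R) (P : Prop)
    j (F C : fgmod R) (w : {linear F -> C}) :
  minimal_resolution M Z j w -> M Z -> X Z ->
  forall (t : nat) (e : chain R) (v : {linear e 0%N -> F}),
  let E := chain_cons v in
  left_closed_under_extensions (t + j).+1 M X ->
  surjective_map w -> (forall y, w y = 0 <-> exists z, v z = y) ->
  (forall i, (i <= t)%N -> exact_at (chain_map E) t.+2 i.+1) ->
  (forall i, (i <= t.+1)%N -> M (E i)) ->
  (forall i, (i < t)%N -> radical (chain_map E i)) ->
  X (E t.+1) -> (X (E t) -> P) -> P.
Proof.
move=> res MZ XZ; elim: res => {j F C w}.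
  move=> F C w i isoi t e v E; rewrite addn0 => closX surjw exw exE ME radE XE; apply.
  have [i' [iK i'K]] := isoi.
  pose c := @chain_cons R Z E (hom_comp i w).
  apply: (closX c) => //; last first.
    by move=> [//|k]; rewrite !ltnS => /radE.
  split=> [[|k]|[|[|k]]] //.
  - by rewrite ltnS => /ME.
  - move=> _ y; split=> // _; have [z Dz] := surjw (i' y).
    by exists z; rewrite /= Dz i'K.
  - move=> _ y; rewrite /= ?ltnS ?leq0n; split.
      by move=> iw; apply/exw; rewrite -(iK (w y)) iw linear0.
    by move/exw => ->; rewrite linear0.
  - by rewrite !ltnS => kt; exact: exE kt.
move=> j F C c C' w a b Mc [inja surjb exb] rad_aw _ IH.
move=> t e v E closX surjw exw exE ME radE XE XP.
apply: (IH t.+1 E (hom_comp a w)) => //.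
- by rewrite addSnnS.
- move=> y; split=> [/exb [x <-]|[z <-]]; last by apply/exb; exists (w z).
  by have [z <-] := surjw x; exists z.
- move=> [_|i]; last by rewrite ltnS => /exE.
  move=> y; rewrite /= ?ltnS ?leq0n; split=> [aw|/exw /= ->]; last by rewrite linear0.
  by apply/exw/(inj_eq0 inja).
- by move=> [|i] //; rewrite ltnS => /ME.
- by move=> [|i] //; rewrite ltnS => /radE.
Qed.

Lemma minimal_resolution_closed_start (M X : fgmod R -> Prop) (Z : fgmod R)
    (P : Prop) j (A F C : fgmod R) (v : {linear A -> F}) (w : {linear F -> C}) :
  minimal_resolution M Z j w -> left_closed_under_extensions j.+1 M X ->
  M Z -> X Z -> M A -> X A -> M F -> short_exact v w -> (X F -> P) -> P.
Proof.
move=> res closX MZ XZ MA XA MF [injv surjw exw] XP.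
(* Only [e 0] is relevant for [t = 0]; the remaining terms and maps are fillers. *)
pose e := @Chain R (fun=> A) (fun=> 0).
apply: (minimal_resolution_closed res MZ XZ (t := 0%N) (e := e) (v := v)) => //.
- move=> [|//] _ y; rewrite /=; split=> [|->]; last exact: linear0.
  exact: inj_eq0.
- by move=> [|[]].
Qed.

End AlmostMinimal.

(** * Reduction to almost minimal sequences *)

Section Reduction.
Context {R : nzRingType}.
Context (finite_len : forall A : fgmod R, exists N, len_le A N).
Context (n : nat) (M : fgmod R -> Prop).
Context (ctM : cluster_tilting n M).

(** Cocycles with values in [A] become coboundaries in [B], and [r] carries the primitives back. *)
Lemma ct_retract (A B : fgmod R) (i : {linear A -> B}) (r : {linear B -> A}) :
  M B -> (forall x, r (i x) = x) -> M A.
Proof.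
move=> MB iK; apply: (ct_Ext_char ctM) => Y MY [//|j] jn; apply/Ext_eq0 => phi coc.
have /Ext_eq0 EB := ct_Ext_vanish ctM MY MB jn.
have [h Dh] := EB _ (cocycle_comp i coc).
by exists (hom_comp r h) => x; rewrite hom_compE -Dh hom_compE iK.
Qed.

(* If [F -> C -> c] is not radical, Fitting's lemma provides a nonzero direct
   summand of [F] mapped isomorphically onto a direct summand of [c], and both
   can be split off. *)
Lemma resolution_reduce (Z : fgmod R) j N C : resolved M Z j N C ->
  forall (A F : fgmod R) (al : {linear A -> F}) (be : {linear F -> C}) N0,
  M F -> short_exact al be -> len_le F N0 ->
  minimal_resolution M Z j be \/
  exists (F' C' : fgmod R) (al' : {linear A -> F'}) (be' : {linear F' -> C'})
    (q : {linear F -> F'}) (i : {linear F' -> F}) N0' N',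
  [/\ M F', short_exact al' be', len_le F' N0' /\ (N0' + N' < N0 + N)%N,
      resolved M Z j N' C' &
      (forall z, q (al z) = al' z) /\ (forall z, i (al' z) = al z)].
Proof.
elim=> {j N C} [C i isoi|j Nc N C c C' a b Mc exab lenc resC' IH];
  move=> A F al be N0 MF exF lenF.
  by left; apply: minimal_resolution0 isoi.
(* The tail is treated first, with [C] and [c] in the roles of [A] and [F]; reducing it leaves [F]
   and [C] unchanged. *)
have [minb|] := IH _ _ _ _ _ Mc exab lenc; last first.
  move=> [c' [C'' [a' [b' [_ [_ [Nc' [N' [Mc' exab' [lenc' ltN] resC'' _]]]]]]]]].
  right; exists F, C, al, be, idfun, idfun, N0, (Nc' + N')%N; split=> //.
    by split; rewrite // ltn_add2l.
  exact: resolvedS Mc' exab' lenc' resC''.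
case: (pselect (radical (hom_comp a be))) => [rad|nrad].
  by left; apply: minimal_resolutionS rad minb.
have [u uE] : exists u : {linear F -> c}, u = hom_comp a be by eexists.
right; rewrite -uE in nrad.
have [g ng] : exists g : {linear c -> F}, ~ is_iso (idfun \- (g \o u)).
  by apply: contrapT => ng; apply: nrad => g; apply: contrapT => nig; apply: ng; exists g.
have [r [rur [x0 rux0]]] := fitting_idempotent finite_len ng.
have [inja surjb exb] := exab; have [injal surjbe exbe] := exF.
have bu z : b (u z) = 0 by rewrite uE; apply/exb; exists (be z).
have ual z : u (al z) = 0.
  by rewrite uE hom_compE (_ : be (al z) = 0) ?linear0 //; apply/exbe; exists z.
(* Since [r u r = r], both [r u] and [u r] are idempotent; [F'] and [c'] are the complements of the
   summands that [u] identifies. *)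
pose F' := ker_fg finite_len (hom_comp r u); pose iF : {linear F' -> F} := kernel_incl _.
pose c' := ker_fg finite_len (hom_comp u r); pose ic : {linear c' -> c} := kernel_incl _.
have iF_inj : injective iF by exact: kernel_incl_inj.
have ic_inj : injective ic by exact: kernel_incl_inj.
have ruF z : r (u (iF z)) = 0 by exact: kernelE z.
have urc z : u (r (ic z)) = 0 by exact: kernelE z.
have [q Dq] : exists q : {linear F -> F'}, forall x, iF (q x) = x - r (u x).
  have [|q Dq] := to_kernel (f := hom_comp r u)
      (h := (idfun : {linear F -> F}) - hom_comp r u); last by exists q.
  by move=> x; rewrite homBE linearB !hom_compE rur subrr.
have [qc Dqc] : exists qc : {linear c -> c'}, forall x, ic (qc x) = x - u (r x).
  have [|qc Dqc] := to_kernel (f := hom_comp u r)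
      (h := (idfun : {linear c -> c}) - hom_comp u r); last by exists qc.
  by move=> x; rewrite homBE linearB !hom_compE rur subrr.
have qK z : q (iF z) = z by apply: iF_inj; rewrite Dq ruF subr0.
have qcK z : qc (ic z) = z by apply: ic_inj; rewrite Dqc urc subr0.
pose C1 := ker_fg finite_len (hom_comp b ic).
pose i1 : {linear C1 -> c'} := kernel_incl _.
have i1_inj : injective i1 by exact: kernel_incl_inj.
have [al' Dal'] : exists al' : {linear A -> F'}, forall z, iF (al' z) = al z.
  have [|al' Dal'] := to_kernel (f := hom_comp r u) (h := al); last by exists al'.
  by move=> z; rewrite hom_compE ual linear0.
have [u' Du'] : exists u' : {linear F' -> c'}, forall z, ic (u' z) = u (iF z).
  have [|u' Du'] := to_kernel (f := hom_comp u r) (h := hom_comp u iF); last by exists u'.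
  by move=> z; rewrite !hom_compE ruF linear0.
have [be' Dbe'] : exists be' : {linear F' -> C1}, forall z, i1 (be' z) = u' z.
  have [|be' Dbe'] := to_kernel (f := hom_comp b ic) (h := u'); last by exists be'.
  by move=> z; rewrite hom_compE Du' bu.
(* [x0] lies outside [F'], so the bound for [F] drops by one, while [c'] keeps the bound of [c]. *)
have [|N0_gt0 lenF'] := len_le_proper iF_inj _ lenF.
  by exists x0 => x Dx; apply: rux0; rewrite -Dx ruF.
exists F', C1, al', be', q, iF, N0.-1, (Nc + N)%N; split.
- exact: ct_retract MF qK.
- split.
  + by apply: injective0 => z al'0; apply: (inj_eq0 injal); rewrite -Dal' al'0 linear0.
  + move=> y; have /exb [w Dw] := kernelE y; have [z Dz] := surjbe w.
    have Du : u z = ic (i1 y) by rewrite uE hom_compE Dz Dw.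
    exists (q z); apply: i1_inj; apply: ic_inj.
    by rewrite Dbe' Du' Dq linearB Du urc subr0.
  + move=> z; split=> [be0|[w <-]].
      have uz : u (iF z) = 0 by rewrite -Du' -Dbe' be0 !linear0.
      have /exbe [w Dw] : be (iF z) = 0 by apply: (inj_eq0 inja); rewrite -hom_compE -uE.
      by exists w; apply: iF_inj; rewrite Dal'.
    by apply: i1_inj; apply: ic_inj; rewrite Dbe' Du' Dal' ual !linear0.
- by split=> //; rewrite ltn_add2r ltn_predL.
- apply: (@resolvedS _ M Z j Nc N C1 c' C' i1 (hom_comp b ic)) => //.
  + exact: ct_retract Mc qcK.
  + split=> // [y|y].
      have [x <-] := surjb y; exists (qc x).
      by rewrite hom_compE Dqc linearB bu subr0.
    by split=> [/kernelP//|[z <-]]; apply: kernelE.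
  + exact: len_le_inj ic_inj lenc.
- by split=> // z; apply: iF_inj; rewrite Dq Dal' ual linear0 subr0.
Qed.

(** Reduction stops because the total length bound decreases. The map [q] carries primitives from
    [F] to [F'], and [i] lets maps extended from [A] to [F] be restricted to [F']. *)
Lemma minimal_resolution_exists (Z A F C : fgmod R) (al : {linear A -> F})
    (be : {linear F -> C}) j N : resolved M Z j N C -> M F -> short_exact al be ->
  exists (F' C' : fgmod R) (al' : {linear A -> F'}) (be' : {linear F' -> C'})
    (q : {linear F -> F'}) (i : {linear F' -> F}),
  [/\ M F', short_exact al' be', minimal_resolution M Z j be' &
      (forall z, q (al z) = al' z) /\ (forall z, i (al' z) = al z)].
Proof.
have [N0 lenF] := finite_len F; have [s] := ubnP (N0 + N).
elim: s => // s IH in F C al be N N0 lenF *; rewrite ltnS => leNs resC MF exF.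
have [minbe|] := resolution_reduce resC MF exF lenF.
  by exists F, C, al, be, idfun, idfun.
move=> [F1 [C1 [al1 [be1 [q1 [i1 [N1 [N' [MF1 ex1 [len1 ltN] res1 [Dq1 Di1]]]]]]]]]].
have [|F' [C' [al' [be' [q [i [MF' ex' minbe' [Dq Di]]]]]]]] :=
  IH _ _ _ _ _ _ len1 _ res1 MF1 ex1; first exact: leq_trans ltN leNs.
exists F', C', al', be', (hom_comp q q1), (hom_comp i1 i); split=> //.
by split=> z; rewrite hom_compE ?Dq1 ?Dq // Di Di1.
Qed.

End Reduction.

(** * The vanishing map and the proof of Wakamatsu's Lemma *)

Section Wakamatsu.
Context {R : nzRingType}.
Context (finite_len : forall A : fgmod R, exists N, len_le A N).

Lemma cover_Ext_zero n (M X : fgmod R -> Prop) (x m K x' : fgmod R)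
    (f : {linear x -> m}) (g : {linear K -> x})
    (phi : {linear res x' n.+1 -> K}) :
  cluster_tilting n.+1 M -> (forall a, X a -> M a) ->
  left_closed_under_extensions n.+1 M X -> M m -> is_cover X f -> X x' ->
  (forall z, f (g z) = 0) -> is_cocycle phi -> coboundary (hom_comp g phi).
Proof.
move=> ctM subXM extX Mm [[Xx pref] isof] Xx' fg coc.
have Mx := subXM _ Xx; have Mx' := subXM _ Xx'.
have cocg := cocycle_comp g coc.
have [E [j [inj_j cobj extj]]] := Ext_effaceable finite_len cocg.
have [|f1 Df1] := extj m f; first by move=> z; rewrite hom_compE.
have [mt [p [[Mmt prep] inj_p]]] := ct_inj_preenvelope ctM E.
have [f2 Df2] := prep m Mm f1.
have inj_pj : injective (hom_comp p j) by move=> z z' /inj_p/inj_j.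
have cobpj : coboundary (hom_comp (hom_comp p j) (hom_comp g phi)).
  by have [h Dh] := coboundary_post p cobj; exists h.
have [F [C [al [be [ka [N [exF Dka resC [h Dh] vanF]]]]]]] :=
  extension_resolution finite_len ctM Mx' (ltnSn n) inj_pj Mmt cocg cobpj.
have MF : M F by apply: (ct_Ext_char ctM) => Y MY i; rewrite ltnS; apply: vanF.
have [F' [C' [al' [be' [q [i [MF' exF' minF' [Dq Di]]]]]]]] :=
  minimal_resolution_exists finite_len ctM resC MF exF.
apply: (minimal_resolution_closed_start minF' extX Mx' Xx' Mx Xx MF' exF') => XF'.
(* The extension of [f] to [F'] factors as [f r]. Hence [f (r al') = f], and the cover property
   makes [r al'] an automorphism. *)
have [r Dr] := pref F' XF' (hom_comp f2 (hom_comp ka i)).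
have [|s [rK _]] := isof (hom_comp r al').
  move=> z; have /= -> := Dr (al' z); rewrite Di Dka -Df1.
  exact: Df2.
(* [s r] is a left inverse of [al'], so it turns the primitive [q h] of [al' g phi] into one of
   [g phi]. *)
exists (hom_comp s (hom_comp r (hom_comp q h))) => z.
have Dz : al (g (phi z)) = h (res_diff x' n z) := Dh z.
have gz : s (r (al' (g (phi z)))) = g (phi z) := rK (g (phi z)).
by rewrite -Dq Dz in gz; rewrite hom_compE -gz.
Qed.

(** [M] is generating, so every kernel is covered by an object of [M], on which the exactness of Hom
    can be tested. *)
Lemma Hom_exact_exact (M : fgmod R -> Prop) (c : chain R) N i :
  generating M ->
  (forall a, M a -> exact_at (@Hom_map R a c) N i.+1) ->
  exact_at (chain_map c) N i.+1.
Proof.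
move=> genM ex y; split=> [dy|].
  have [a Ma [e surje]] := genM (ker_fg finite_len (chain_map c i)).
  have [z Dz] := kernelP dy; have [t Dt] := surje z.
  pose e' : {linear a -> c i.+1} := hom_comp (kernel_incl (chain_map c i)) e.
  have De' : e' t = y by rewrite /e' hom_compE Dt Dz.
  have : Hom_map e' = 0 by apply: linear_ext => w; apply: (kernelE (e w)).
  move/(ex a Ma e'); case: ifP => _; last by rewrite -De' => ->.
  by move=> [w Dw]; exists (w t); rewrite -De' -Dw.
case: ifP => [iN [z <-]|_ ->]; last by rewrite linear0.
have [a Ma [e surje]] := genM (c i.+2); have [t <-] := surje z.
have := (ex a Ma (Hom_map e)).2; rewrite iN => /(_ (ex_intro _ e erefl)).
by move/(congr1 (fun h : {linear _ -> _} => h t)).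
Qed.

End Wakamatsu.

(* Right modules over L are modules over the converse algebra L^c. *)
Theorem theorem4p2 (n : nat) (n_ge1 : (1 <= n)%N)
    (k : comNzRingType) (L : algType k) (artinL : artin_algebra L)
    (M : fgmod L^c -> Prop) (ctM : nZ_cluster_tilting n M)
    (X : fgmod L^c -> Prop) (subXM : forall a, X a -> M a)
    (extX : left_closed_under_extensions n M X)
    (m : fgmod L^c) (Mm : M m)
    (x : fgmod L^c) (f : {linear x -> m}) (coverf : is_cover X f)
    (surjf : surjective_map f) :
  forall (K : chain L^c) (g : {linear K 0%N -> x}), n_kernel n M f g ->
  forall x' : fgmod L^c, X x' ->
  forall i, (i < n)%N -> exact_at (@Ext_chain_map _ n x' K) n i.
Proof.
have [ct LES] := ctM; have finite_len := artin_algebra_len artinL.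
have [_ _ [genM _] _ _] := ct.
move=> K g [MK exK] x' Xx'; have [[Xx pref] _] := coverf.
pose c := @chain_cons L^c m (chain_cons g) f.
have exc i : (i < n.+2)%N -> exact_at (chain_map c) n.+2 i.
  case: i => [_ y|i iN]; first by split=> // _; apply: surjf.
  by apply: (Hom_exact_exact finite_len genM) => a Ma; apply: exK.
have nexc : n_exact n M c.
  split=> // -[|[|i]] //; first by move=> _; apply: subXM.
  by rewrite !ltnS => /MK.
have fg z : f (g z) = 0.
  have /(_ isT (g z)) [_ h] := exc 1%N; apply: h.
  by rewrite !ltnS n_ge1; exists z.
have g0 (y : Ext n x' (K 0%N)) : Ext_map g y = 0.
  case: n n_ge1 ct extX y {ctM LES exK exc nexc MK} => // n _ ct' extX' y.
  have [phi ->] := Ext_classP y; rewrite Ext_mapE; apply/Ext_class_eq0.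
  exact: (cover_Ext_zero finite_len ct' subXM extX' Mm coverf Xx' fg
    (@cocycle_is_cocycle _ _ _ _ phi)).
have [d0 [d [_ exd0 exd0' /(_ 1%N isT) [exE _ _]]]] := LES x' c (subXM _ Xx') nexc.
(* Every map [x' -> m] factors through the precover [f], so the connecting map [d0] is zero and the
   first map between the Ext groups is injective. *)
have injE (y : Ext (1 * n) x' (c n.+1)) : Ext_chain_map (c := c) y = 0 -> y = 0.
  move=> /exd0' [t <-]; apply/exd0; have [h Dh] := pref x' Xx' t.
  by exists h; apply: linear_ext.
rewrite mul1n in exE injE.
have {}injE l (y : Ext n x' (c l.+1)) : l = n -> Ext_chain_map (c := c) y = 0 -> y = 0.
  by move=> Dl; case: _ / (esym Dl) in y *; apply: injE.
(* In [c] the term [K i] has index [i.+2]. At [K 0] every class is killed by [g0], so it comes from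
   [K 1] if [1 < n] and is zero by [injE] if [n = 1]. *)
move=> [|i] iN.
  move=> y; split=> // _; case: ltnP => [n1|n1].
    by have /(_ n1 y) := exE 2; rewrite [(3 < _)%N]n1 => -[h _]; apply: h; apply: g0.
  by apply: (injE 1%N); [apply/eqP; rewrite eqn_leq n1 n_ge1|apply: g0].
(* Interior positions come from the long exact sequence; otherwise [i.+2 = n] and the position is
   the left end, settled by [injE]. *)
have [i2n|ni] := ltnP i.+2 n; first exact: (exE i.+3 i2n).
move=> y; rewrite ltnNge ni /=; split=> [|->]; last exact: raddf0.
by apply: (injE i.+2); apply/eqP; rewrite eqn_leq ni iN.
Qed.
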